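(* Let $E$, $F$ be normed spaces and $\tilde i:E\to F$ an isometric operator such that the operator $\tilde i\otimes_p\mathbf{1}:E\otimes_p(\ell_\infty/c_0)\to F\otimes_p(\ell_\infty/c_0)$ is not an isometry. Put $X:=\ell_\infty\otimes_i E$, $Y:=\ell_\infty\otimes_i F$ and $\mathbf{i}:=\mathbf{1}_{\ell_\infty}\otimes_i\tilde i:X\to Y$. Then the morphism $\mathbf{i}\otimes_{c_0}\mathbf{1}_{\ell_\infty}:X\otimes_{c_0}\ell_\infty\to Y\otimes_{c_0}\ell_\infty$ is not an isometry. As a corollary, the $c_0$-module $\ell_\infty$ is not extremely flat with respect to the class of all homogeneous normed $c_0$-modules.
   Context: All spaces are complex; normed spaces and modules are not assumed complete. $c_0$ is the Banach algebra of complex sequences converging to $0$, with coordinate-wise operations and the uniform norm; $\mathbf{p}^n\in c_0$ is the sequence whose $n$-th term is $1$ and all other terms are $0$. A normed $c_0$-module is a normed space $X$ that is a $c_0$-module and is contractive: $\|a\cdot x\|\le\|a\|\|x\|$ (all normed modules are assumed contractive; since $c_0$ is commutative, left and right modules are identified). A morphism is a linear map commuting with the module multiplication; ''isometric'' (or ''an isometry'') means norm-preserving (not necessarily surjective). $\ell_\infty$ is a $c_0$-module under coordinate-wise multiplication, with the uniform norm; $\ell_\infty/c_0$ is the quotient normed space. $\otimes_p$ and $\otimes_i$ denote the non-completed projective and, respectively, injective tensor products of normed spaces and of bounded operators. $\ell_\infty\otimes_i E$ is a $c_0$-module with the multiplication well defined by $\xi\cdot(\eta\otimes x):=\xi\eta\otimes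 x$ for $\xi\in c_0,\eta\in\ell_\infty,x\in E$; similarly for $\ell_\infty\otimes_i F$. Spaces $E,F$ and an operator $\tilde i$ as in the claim exist by a theorem of Grothendieck, since $\ell_\infty/c_0$ is not isometrically isomorphic to any space $L_1(\Omega,\mu)$. For normed $c_0$-modules $X,Z$, the (non-completed) projective module tensor product $X\otimes_{c_0}Z$ is the quotient normed space of $X\otimes_p Z$ by the closure of the linear span of all elements $(a\cdot x)\otimes z-x\otimes(a\cdot z)$, $a\in c_0,x\in X,z\in Z$. The image of $x\otimes z$ is denoted $x\otimes_{c_0}z$. For a bounded morphism $\varphi:X\to Y$, the operator $\varphi\otimes_{c_0}\mathbf{1}_Z$ is well defined by $x\otimes_{c_0}z\mapsto\varphi(x)\otimes_{c_0}z$. A normed $c_0$-module $X$ is homogeneous if, for all $x,y\in X$, the equalities $\|\mathbf{p}^n\cdot x\|=\|\mathbf{p}^n\cdot y\|$ for all $n$ imply $\|x\|=\|y\|$. A normed $c_0$-module $Z$ is extremely flat with respect to a class $\mathcal{K}$ of normed $c_0$-modules if, for every isometric morphism $j:X\to Y$ of modules belonging to $\mathcal{K}$, the operator $j\otimes_{c_0}\mathbf{1}_Z:X\otimes_{c_0}Z\to Y\otimes_{c_0}Z$ is also isometric. *)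

(* Defs.v *)
From HB Require Import structures.
From mathcomp Require Import all_boot all_order all_algebra.
From mathcomp Require Import sesquilinear ring_quotient generic_quotient.
From mathcomp Require Import all_classical all_reals all_analysis.
From mathcomp Require Import complex.

Set Implicit Arguments.
Unset Strict Implicit.
Unset Printing Implicit Defensive.

Import Order.TTheory GRing.Theory Num.Theory.
Import numFieldNormedType.Exports.

Local Open Scope classical_set_scope.
Local Open Scope ring_scope.
Local Open Scope complex_scope.
Local Open Scope quotient_scope.

(* The norm of a complex normed space takes its values in [R[i]]; [rnorm] is
   the same number in [R], where suprema and infima live. *)
Definition rnorm (R : realType) (V : normedZmodType R[i]) (x : V) : R :=
  complex.Re `|x|.

Section RealNorm.
Variable R : realType.

Lemma rnormE (V : normedZmodType R[i]) (x : V) : `|x| = (rnorm x)%:C.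
Proof. by rewrite /rnorm RRe_real // ger0_real. Qed.

Lemma rnorm_ge0 (V : normedZmodType R[i]) (x : V) : 0 <= rnorm x.
Proof. by rewrite -ler0c -rnormE. Qed.

Lemma rnorm0 (V : normedZmodType R[i]) : rnorm (0 : V) = 0.
Proof. by rewrite /rnorm normr0. Qed.

Lemma rnormN (V : normedZmodType R[i]) (x : V) : rnorm (- x) = rnorm x.
Proof. by rewrite /rnorm normrN. Qed.

Lemma rnormD (V : normedZmodType R[i]) (x y : V) :
  rnorm (x + y) <= rnorm x + rnorm y.
Proof. by rewrite -lecR rmorphD /= -!rnormE ler_normD. Qed.

Lemma rnorm_eq0 (V : normedZmodType R[i]) (x : V) : rnorm x = 0 -> x = 0.
Proof. by move=> h; apply/normr0_eq0; rewrite rnormE h. Qed.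

Lemma rnormZ (V : normedModType R[i]) (c : R[i]) (x : V) :
  rnorm (c *: x) = rnorm c * rnorm x.
Proof. by apply: complexI; rewrite rmorphM /= -!rnormE normrZ. Qed.

Lemma rnormM (a b : R[i]) : rnorm (a * b) = rnorm a * rnorm b.
Proof. by apply: complexI; rewrite rmorphM /= -!rnormE normrM. Qed.

Lemma rnorm_sum (V : normedZmodType R[i]) I (s : seq I) (F : I -> V) :
  rnorm (\sum_(i <- s) F i) <= \sum_(i <- s) rnorm (F i).
Proof.
elim/big_ind2 : _ => [|x r y t h1 h2|//]; first by rewrite rnorm0.
by apply: le_trans (rnormD _ _) _; apply: lerD.
Qed.

Lemma ler_rnorm (V W : normedZmodType R[i]) (x : V) (y : W) :
  (`|x| <= `|y|) = (rnorm x <= rnorm y).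
Proof. by rewrite !rnormE lecR. Qed.

Lemma rnorm_real (r : R) : rnorm r%:C = `|r|.
Proof. by rewrite /rnorm normc_def /= expr0n /= addr0 sqrtr_sqr. Qed.

End RealNorm.

HB.factory Record Lmodule_hasRealNorm (R : realType) V
    & GRing.Lmodule R[i] V := {
  realnorm : V -> R ;
  realnormD : forall x y, realnorm (x + y) <= realnorm x + realnorm y ;
  realnormZ : forall c x, realnorm (c *: x) = rnorm c * realnorm x ;
  realnorm0_eq0 : forall x, realnorm x = 0 -> x = 0
}.

HB.builders Context R V & Lmodule_hasRealNorm R V.

Let norm (x : V) : R[i] := (realnorm x)%:C.

Let normD x y : norm (x + y) <= norm x + norm y.
Proof. by rewrite /norm -rmorphD /= lecR realnormD. Qed.

Let norm_scale (c : R[i]) x : norm (c *: x) = `|c| * norm x.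
Proof. by rewrite /norm realnormZ rmorphM /= -rnormE. Qed.

Let norm0_eq0 x : norm x = 0 -> x = 0.
Proof. by move/complexI/realnorm0_eq0. Qed.

HB.instance Definition _ :=
  Lmodule_isNormed.Build R[i] V normD norm_scale norm0_eq0.

HB.end.

Section Linf.
Variable R : realType.
Local Notation C := R[i].

Definition bounded_seq : {pred nat -> C} :=
  [pred x | `[< exists M : R, forall n, rnorm (x n) <= M >]].

Fact bounded_seq_submod : submod_closed bounded_seq.
Proof.
split=> [|c x y /asboolP[M hM] /asboolP[N hN]]; apply/asboolP.
  by exists 0 => n; rewrite /= rnorm0.
exists (rnorm c * M + N) => n.
rewrite (le_trans (rnormD _ _)) // lerD // ?hN //.
by rewrite rnormM ler_wpM2l ?rnorm_ge0.
Qed.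
HB.instance Definition _ :=
  GRing.isSubmodClosed.Build C (nat -> C) bounded_seq bounded_seq_submod.

Record linf := Linf { linf_val :> nat -> C ; linf_valP : linf_val \in bounded_seq }.

HB.instance Definition _ := [isSub for linf_val].
HB.instance Definition _ := [Choice of linf by <:].
HB.instance Definition _ := [SubChoice_isSubLmodule of linf by <:].

Definition linf_norm (x : linf) : R := sup [set rnorm (x n) | n in [set: nat]].

Lemma linf_norm_ub (x : linf) n : rnorm (x n) <= linf_norm x.
Proof.
apply: ub_le_sup; last by exists n.
by have /asboolP[M hM] := linf_valP x; exists M => _ [k _ <-].
Qed.

Lemma linf_norm_le (x : linf) (M : R) :
  (forall n, rnorm (x n) <= M) -> linf_norm x <= M.
Proof. by move=> h; apply: ge_sup; [exists (rnorm (x 0%N)), 0%N|move=> _ [n _ <-]]. Qed.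

Lemma linf_ext (x y : linf) : (forall n, x n = y n) -> x = y.
Proof. by move=> h; apply/val_inj/funext. Qed.

End Linf.

Section LinfNorm.
Variable R : realType.
Local Notation C := R[i].

Let linf_normD (x y : linf R) : linf_norm (x + y) <= linf_norm x + linf_norm y.
Proof.
apply: linf_norm_le => n; apply: le_trans (rnormD _ _) _.
by apply: lerD; exact: linf_norm_ub.
Qed.

Let linf_normZ (c : C) (x : linf R) :
  linf_norm (c *: x) = rnorm c * linf_norm x.
Proof.
have le (d : C) (y : linf R) : linf_norm (d *: y) <= rnorm d * linf_norm y.
  apply: linf_norm_le => n.
  by rewrite rnormM ler_wpM2l ?rnorm_ge0 ?linf_norm_ub.
have norm_ge0 (y : linf R) : 0 <= linf_norm y.
  exact: le_trans (rnorm_ge0 (y 0%N)) (linf_norm_ub y 0%N).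
apply/le_anti; rewrite le /=; have [->|c0] := eqVneq c 0.
  by rewrite rnorm0 mul0r.
have := ler_wpM2l (rnorm_ge0 c) (le c^-1 (c *: x)).
rewrite scalerA mulVf // scale1r mulrA -rnormM divff //.
suff -> : rnorm (1 : C) = 1 by rewrite mul1r.
by rewrite /rnorm normr1.
Qed.

Let linf_norm0_eq0 (x : linf R) : linf_norm x = 0 -> x = 0.
Proof.
move=> x0; apply: linf_ext => n; apply: rnorm_eq0; apply/le_anti.
by rewrite rnorm_ge0 andbT -x0 linf_norm_ub.
Qed.

HB.instance Definition _ := Lmodule_hasRealNorm.Build R (linf R)
  linf_normD linf_normZ linf_norm0_eq0.

Lemma rnorm_linf (x : linf R) : rnorm x = linf_norm x.
Proof. by []. Qed.

Fact linf_mul_subproof (x y : linf R) :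
  (fun n => x n * y n : C) \in @bounded_seq R.
Proof.
apply/asboolP; exists (linf_norm x * linf_norm y) => n.
by rewrite rnormM ler_pM ?rnorm_ge0 ?linf_norm_ub.
Qed.
Definition linf_mul (x y : linf R) : linf R := Linf (linf_mul_subproof x y).

Lemma linf_mul_norm (x y : linf R) :
  rnorm (linf_mul x y) <= rnorm x * rnorm y.
Proof.
apply: linf_norm_le => n.
by rewrite rnormM ler_pM ?rnorm_ge0 ?linf_norm_ub.
Qed.

Lemma linf_mulC : commutative linf_mul.
Proof. by move=> x y; apply: linf_ext => n; rewrite /= mulrC. Qed.

Lemma linf_mulA : associative linf_mul.
Proof. by move=> x y z; apply: linf_ext => n; rewrite /= mulrA. Qed.

Lemma linf_mulDr x y z : linf_mul x (y + z) = linf_mul x y + linf_mul x z.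
Proof. by apply: linf_ext => n; rewrite /= -mulrDr. Qed.

Lemma linf_mulZr x c y : linf_mul x (c *: y) = c *: linf_mul x y.
Proof. by apply: linf_ext => n; rewrite /= mulrCA. Qed.

Lemma linf_mulDl x y z : linf_mul (x + y) z = linf_mul x z + linf_mul y z.
Proof. by rewrite linf_mulC linf_mulDr !(linf_mulC z). Qed.

Lemma linf_mulZl c x y : linf_mul (c *: x) y = c *: linf_mul x y.
Proof. by rewrite linf_mulC linf_mulZr linf_mulC. Qed.

End LinfNorm.

Section C0.
Variable R : realType.
Local Notation C := R[i].

Definition c0_pred : {pred linf R} :=
  [pred x : linf R | `[< (x : nat -> C^o) @ \oo --> (0 : C^o) >]].

Lemma c0_predP (x : linf R) :
  reflect (forall e : R, 0 < e ->
             exists N, forall n, (N <= n)%N -> rnorm (x n) < e)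
          (x \in c0_pred).
Proof.
apply: (iffP (asboolP _)) => [|h].
  move=> /cvgrPdist_lt cx e e0; have e0' : 0 < e%:C by rewrite ltcR.
  have [N _ hN] := cx _ e0'; exists N => n Nn.
  by have := hN n Nn; rewrite /= sub0r normrN rnormE ltcR.
apply/cvgrPdist_lt => e e0.
have eE : (complex.Re e)%:C = e by rewrite RRe_real // gtr0_real.
have [|N hN] := h (complex.Re e); first by rewrite -ltcR eE.
by exists N => // n Nn; rewrite /= sub0r normrN rnormE -eE ltcR; exact: hN.
Qed.

Fact c0_submod : submod_closed c0_pred.
Proof.
split=> [|c x y /c0_predP hx /c0_predP hy]; apply/c0_predP => e e0.
  by exists 0%N => n _; rewrite rnorm0.
have d0 : 0 < e / 2 / (rnorm c + 1).
  by rewrite !divr_gt0 // ltr_wpDl // rnorm_ge0.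
have [N hN] := hx _ d0; have e2 : 0 < e / 2 by rewrite divr_gt0.
have [M hM] := hy _ e2.
exists (maxn N M) => n; rewrite geq_max => /andP[/hN xn /hM yn].
rewrite (le_lt_trans (rnormD _ _)) // (splitr e) ltr_leD //; last exact: ltW.
rewrite rnormM; move: xn; rewrite ltr_pdivlMr ?ltr_wpDl ?rnorm_ge0 //.
by apply: le_lt_trans; rewrite mulrC ler_wpM2l ?rnorm_ge0 // lerDl.
Qed.
HB.instance Definition _ := GRing.isSubmodClosed.Build C (linf R) c0_pred c0_submod.

Record c0 := MkC0 { c0_val :> linf R ; c0_valP : c0_val \in c0_pred }.
HB.instance Definition _ := [isSub for c0_val].
HB.instance Definition _ := [Choice of c0 by <:].
HB.instance Definition _ := [SubChoice_isSubLmodule of c0 by <:].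

Let c0_normD (x y : c0) :
  rnorm (c0_val (x + y)) <= rnorm (c0_val x) + rnorm (c0_val y).
Proof. exact: rnormD. Qed.
Let c0_normZ (c : C) (x : c0) :
  rnorm (c0_val (c *: x)) = rnorm c * rnorm (c0_val x).
Proof. exact: rnormZ. Qed.
Let c0_norm0_eq0 (x : c0) : rnorm (c0_val x) = 0 -> x = 0.
Proof. by move=> /rnorm_eq0 x0; apply: val_inj. Qed.
HB.instance Definition _ := Lmodule_hasRealNorm.Build R c0
  c0_normD c0_normZ c0_norm0_eq0.

Fact c0_mul_subproof (a : c0) (x : linf R) : linf_mul a x \in c0_pred.
Proof.
case: a => a /= /c0_predP ha; apply/c0_predP => e e0.
have k0 : 0 < rnorm x + 1 by rewrite ltr_wpDl // rnorm_ge0.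
have [N hN] := ha _ (divr_gt0 e0 k0); exists N => n /hN.
rewrite ltr_pdivlMr // => /(le_lt_trans _); apply; rewrite /= rnormM.
by rewrite ler_wpM2l ?rnorm_ge0 // (le_trans (linf_norm_ub x n)) // lerDl.
Qed.
Definition c0_mul (a b : c0) : c0 := MkC0 (c0_mul_subproof a b).

Fact pn_bounded (n : nat) : (fun k => (k == n)%:R : C) \in @bounded_seq R.
Proof.
apply/asboolP; exists 1 => k.
by case: (k == n); rewrite ?rnorm0 // /rnorm normr1.
Qed.
Fact pn_c0 (n : nat) : Linf (pn_bounded n) \in c0_pred.
Proof.
apply/c0_predP => e e0; exists n.+1 => k /=; rewrite ltn_neqAle eq_sym.
by move=> /andP[/negbTE -> _]; rewrite rnorm0.
Qed.
(* Terms are numbered from [0]. *)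
Definition pn (n : nat) : c0 := MkC0 (pn_c0 n).

End C0.
Arguments pn {R} n.

HB.mixin Record isC0Module (R : realType) X & NormedModule R[i] X := {
  c0act : c0 R -> X -> X ;
  c0actDl : forall a b x, c0act (a + b) x = c0act a x + c0act b x ;
  c0actZl : forall (c : R[i]) a x, c0act (c *: a) x = c *: c0act a x ;
  c0actDr : forall a x y, c0act a (x + y) = c0act a x + c0act a y ;
  c0actZr : forall (c : R[i]) a x, c0act a (c *: x) = c *: c0act a x ;
  c0actA : forall a b x, c0act a (c0act b x) = c0act (c0_mul a b) x ;
  c0act_norm : forall a x, `|c0act a x| <= `|a| * `|x|
}.

#[short(type="normedC0Module")]
HB.structure Definition NormedC0Module (R : realType) :=
  { X of isC0Module R X & NormedModule R[i] X }.

Section LinfModule.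
Variable R : realType.
Let act (a : c0 R) (x : linf R) := linf_mul a x.
Let actDl (a b : c0 R) x : act (a + b) x = act a x + act b x.
Proof. exact: linf_mulDl. Qed.
Let actZl (c : R[i]) (a : c0 R) x : act (c *: a) x = c *: act a x.
Proof. exact: linf_mulZl. Qed.
Let actDr (a : c0 R) x y : act a (x + y) = act a x + act a y.
Proof. exact: linf_mulDr. Qed.
Let actZr (c : R[i]) (a : c0 R) x : act a (c *: x) = c *: act a x.
Proof. exact: linf_mulZr. Qed.
Let actA (a b : c0 R) x : act a (act b x) = act (c0_mul a b) x.
Proof. exact: linf_mulA. Qed.
Let act_norm (a : c0 R) x : `|act a x| <= `|a| * `|x|.
Proof. by rewrite !rnormE -rmorphM lecR; exact: linf_mul_norm. Qed.
HB.instance Definition _ :=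
  isC0Module.Build R (linf R) actDl actZl actDr actZr actA act_norm.
End LinfModule.

Lemma closure_rnormP (R : realType) (V : normedModType R[i]) (A : set V) (x : V) :
  closure A x <-> forall e : R, 0 < e -> exists2 y, A y & rnorm (x - y) < e.
Proof.
split=> [cx e e0|h B].
  have e0' : 0 < e%:C by rewrite ltcR.
  have [y [Ay]] := cx _ (nbhsx_ballx x _ e0').
  by rewrite -ball_normE /= rnormE ltcR; exists y.
move=> /nbhs_ballP[e /= e0 eB].
have eE : (complex.Re e)%:C = e by rewrite RRe_real // gtr0_real.
have [|y Ay xy] := h (complex.Re e); first by rewrite -ltcR eE.
by exists y; split => //; apply: eB; rewrite -ball_normE /= rnormE -eE ltcR.
Qed.

Record closedSubspace (R : realType) (V : normedModType R[i]) := ClosedSubspace {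
  subspace_pred :> {pred V} ;
  subspace_submod : submod_closed subspace_pred ;
  subspace_closed : closed [set x | x \in subspace_pred]
}.

HB.instance Definition _ (R : realType) (V : normedModType R[i])
    (W : closedSubspace V) :=
  GRing.isSubmodClosed.Build R[i] V (subspace_pred W) (subspace_submod W).

Definition nquot (R : realType) (V : normedModType R[i])
  (W : closedSubspace V) := Quotient.quot (subspace_pred W : zmodClosed V).

Section NormedQuotient.
Variables (R : realType) (V : normedModType R[i]) (W : closedSubspace V).
Local Notation C := R[i].
Local Notation Q := (nquot W).

HB.instance Definition _ := GRing.Zmodule.on Q.

Definition nquot_pi (x : V) : Q := \pi_Q x.

Lemma nquot_piP x y : nquot_pi x = nquot_pi y <-> x - y \in subspace_pred W.
Proof. by split=> [/eqP|h]; [|apply/eqP]; rewrite -Quotient.idealrBE. Qed.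

Lemma nquot_piK (q : Q) : nquot_pi (repr q) = q.
Proof. exact: reprK. Qed.

Lemma nquot_piD x y : nquot_pi (x + y) = nquot_pi x + nquot_pi y.
Proof. by rewrite /nquot_pi !piE. Qed.

Definition nquot_scale (c : C) (q : Q) : Q := nquot_pi (c *: repr q).

Lemma nquot_scaleE c x : nquot_scale c (nquot_pi x) = nquot_pi (c *: x).
Proof.
apply/nquot_piP; rewrite -scalerBr rpredZ //.
by apply/nquot_piP; rewrite nquot_piK.
Qed.

Let scaleA a b q : nquot_scale a (nquot_scale b q) = nquot_scale (a * b) q.
Proof. by rewrite -(nquot_piK q) !nquot_scaleE scalerA. Qed.
Let scale1 : left_id 1 nquot_scale.
Proof. by move=> q; rewrite -(nquot_piK q) nquot_scaleE scale1r. Qed.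
Let scaleDr : right_distributive nquot_scale +%R.
Proof.
move=> c q r; rewrite -(nquot_piK q) -(nquot_piK r).
by rewrite -nquot_piD !nquot_scaleE scalerDr nquot_piD.
Qed.
Let scaleDl q : {morph nquot_scale^~ q : a b / a + b}.
Proof.
by move=> a b; rewrite -(nquot_piK q) !nquot_scaleE scalerDl nquot_piD.
Qed.
HB.instance Definition _ :=
  GRing.Zmodule_isLmodule.Build C Q scaleA scale1 scaleDr scaleDl.

Lemma nquot_piZ c x : nquot_pi (c *: x) = c *: nquot_pi x.
Proof. by rewrite -nquot_scaleE. Qed.

Definition nquot_norm (q : Q) : R := inf [set rnorm x | x in [set x | nquot_pi x = q]].

Let has_inf_norm q : has_inf [set rnorm x | x in [set x | nquot_pi x = q]].
Proof.
split; first by exists (rnorm (repr q)), (repr q) => //=; exact: nquot_piK.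
by exists 0 => _ [x _ <-]; exact: rnorm_ge0.
Qed.

Lemma nquot_norm_le x : nquot_norm (nquot_pi x) <= rnorm x.
Proof. by apply: ge_inf; [case: (has_inf_norm (nquot_pi x))|exists x]. Qed.

Lemma nquot_norm_ex (q : Q) (e : R) : nquot_norm q < e ->
  exists2 x, nquot_pi x = q & rnorm x < e.
Proof.
move=> qe; have [_ [x xq <-] xe] := inf_lt (has_inf_norm q).1 qe.
by exists x.
Qed.

Lemma nquot_norm_ge (q : Q) (r : R) :
  (forall x, nquot_pi x = q -> r <= rnorm x) -> r <= nquot_norm q.
Proof.
move=> h; apply: lb_le_inf; first by case: (has_inf_norm q).
by move=> _ [x xq <-]; exact: h.
Qed.

Let nquot_normD (p q : Q) : nquot_norm (p + q) <= nquot_norm p + nquot_norm q.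
Proof.
apply/ler_addgt0Pr => e e0.
have e2 : 0 < e / 2 by rewrite divr_gt0.
have [x xp hx] : exists2 x, nquot_pi x = p & rnorm x < nquot_norm p + e / 2.
  by apply: nquot_norm_ex; rewrite ltrDl.
have [y yq hy] : exists2 x, nquot_pi x = q & rnorm x < nquot_norm q + e / 2.
  by apply: nquot_norm_ex; rewrite ltrDl.
rewrite -xp -yq -nquot_piD xp yq (le_trans (nquot_norm_le _)) //.
rewrite (le_trans (rnormD _ _)) // [e in leRHS]splitr addrACA.
by rewrite lerD // ltW.
Qed.

Let nquot_normZ c (q : Q) : nquot_norm (c *: q) = rnorm c * nquot_norm q.
Proof.
have le d (p : Q) : nquot_norm (d *: p) <= rnorm d * nquot_norm p.
  have [->|d0] := eqVneq d 0.
    rewrite rnorm0 mul0r scale0r.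
    have -> : 0 = nquot_pi 0 by rewrite /nquot_pi !piE.
    by rewrite (le_trans (nquot_norm_le _)) // rnorm0.
  have dp : 0 < rnorm d.
    by rewrite lt_neqAle rnorm_ge0 andbT eq_sym; apply: contra_neq d0 => /rnorm_eq0.
  rewrite -ler_pdivrMl //; apply: nquot_norm_ge => x <-.
  by rewrite ler_pdivrMl // -rnormZ -nquot_piZ nquot_norm_le.
apply/le_anti; rewrite le /=; have [->|c0] := eqVneq c 0.
  rewrite rnorm0 mul0r; apply: nquot_norm_ge => x _; exact: rnorm_ge0.
have := ler_wpM2l (rnorm_ge0 c) (le c^-1 (c *: q)).
rewrite scalerA mulVf // scale1r mulrA -rnormM divff //.
suff -> : rnorm (1 : C) = 1 by rewrite mul1r.
by rewrite /rnorm normr1.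
Qed.

Let nquot_norm0_eq0 (q : Q) : nquot_norm q = 0 -> q = 0.
Proof.
move=> q0; rewrite -(nquot_piK q).
have -> : 0 = nquot_pi 0 by rewrite /nquot_pi !piE.
apply/nquot_piP; rewrite subr0.
apply: (@subspace_closed _ _ W); apply/closure_rnormP => e e0.
have [|x xq xe] := @nquot_norm_ex q e; first by rewrite q0.
exists (repr q - x) => /=; last by rewrite opprB addrC subrK.
by apply/nquot_piP; rewrite nquot_piK.
Qed.

HB.instance Definition _ := Lmodule_hasRealNorm.Build R Q
  nquot_normD nquot_normZ nquot_norm0_eq0.

Lemma rnorm_nquot (q : Q) : rnorm q = nquot_norm q.
Proof. by []. Qed.

End NormedQuotient.

Section ClosedSpan.
Variables (R : realType) (V : normedModType R[i]).
Local Notation C := R[i].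

Definition lin_span (S : set V) : set V :=
  [set v | exists s : seq (C * V),
     (forall p, p \in s -> S p.2) /\ v = \sum_(p <- s) p.1 *: p.2].

Lemma lin_span_comb (S : set V) (c : C) (x y : V) :
  lin_span S x -> lin_span S y -> lin_span S (c *: x + y).
Proof.
move=> [s [hs ->]] [t [ht ->]].
exists ([seq (c * p.1, p.2) | p <- s] ++ t); split=> [p|].
  rewrite mem_cat => /orP[/mapP[q qs ->]|]; [exact: (hs q)|exact: ht].
rewrite big_cat big_map scaler_sumr /=; congr (_ + _).
by apply: eq_bigr => p _; rewrite scalerA.
Qed.

Definition closed_span_pred (S : set V) : {pred V} :=
  [pred x : V | `[< closure (lin_span S) x >]].

Fact closed_span_submod (S : set V) : submod_closed (closed_span_pred S).
Proof.
split=> [|c x y /asboolP/closure_rnormP hx /asboolP/closure_rnormP hy].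
  apply/asboolP; apply: subset_closure; exists [::]; split => //.
  by rewrite big_nil.
apply/asboolP/closure_rnormP => e e0.
have e2 : 0 < e / 2 by rewrite divr_gt0.
have c0 : 0 < rnorm c + 1 by rewrite ltr_wpDl // rnorm_ge0.
have [x' sx' xx'] := hx _ (divr_gt0 e2 c0).
have [y' sy' yy'] := hy _ e2.
exists (c *: x' + y'); first exact: lin_span_comb.
rewrite opprD addrACA -scalerBr (le_lt_trans (rnormD _ _)) //.
rewrite [e]splitr ler_ltD // rnormZ.
move: xx'; rewrite ltr_pdivlMr // => /ltW; apply: le_trans.
by rewrite mulrC ler_wpM2l ?rnorm_ge0 // lerDl.
Qed.

Fact closed_span_closed (S : set V) : closed [set x | x \in closed_span_pred S].
Proof.
have -> : [set x | x \in closed_span_pred S] = closure (lin_span S).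
  by apply/seteqP; split => x /asboolP.
exact: closed_closure.
Qed.

Definition closed_span (S : set V) : closedSubspace V :=
  ClosedSubspace (closed_span_submod S) (@closed_span_closed S).

End ClosedSpan.

Section LinfModC0.
Variable R : realType.

Fact c0_closed : closed [set x : linf R | x \in @c0_pred R].
Proof.
move=> x /closure_rnormP h; apply/c0_predP => e e0.
have e2 : 0 < e / 2 by rewrite divr_gt0.
have [y /c0_predP /(_ _ e2)[N hN] xy] := h _ e2.
exists N => n /hN yn; rewrite -(subrK (y n) (x n)).
rewrite (le_lt_trans (rnormD _ _)) // [e]splitr ler_ltD //.
exact: le_trans (linf_norm_ub (x - y) n) (ltW xy).
Qed.

Definition c0_subspace : closedSubspace (linf R) :=
  ClosedSubspace (@c0_submod R) c0_closed.

Definition linf_mod_c0 := nquot c0_subspace.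
HB.instance Definition _ := NormedModule.on linf_mod_c0.

End LinfModC0.

Section HahnBanach.
Variables (R : realType) (V : normedModType R[i]).
Local Notation C := R[i].
Variables (M : set V) (f : V -> C).
Hypothesis M0 : M 0.
Hypothesis M_comb : forall c x y, M x -> M y -> M (c *: x + y).
Hypothesis f_comb : forall c x y, M x -> M y -> f (c *: x + y) = c * f x + f y.
Hypothesis f_le : forall x, M x -> rnorm (f x) <= rnorm x.

(* Graphs of the real-linear extensions of [Re f] dominated by the norm. *)
Let dom_graph (G : set (V * R)) : Prop :=
  [/\ forall x, M x -> G (x, complex.Re (f x)),
      forall r a b, G a -> G b -> G (r%:C *: a.1 + b.1, r * a.2 + b.2) &
      forall a, G a -> a.2 <= rnorm a.1].

Let Re_le (z : C) : complex.Re z <= rnorm z.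
Proof.
by rewrite -lecR -rnormE; apply: le_trans (normc_ge_Re z); rewrite lecR ler_norm.
Qed.

Let graph_f : dom_graph [set (x, complex.Re (f x)) | x in M].
Proof.
split=> [x Mx|r _ _ [x Mx <-] [y My <-]|_ [x Mx <-]] /=.
- by exists x.
- exists (r%:C *: x + y); first exact: M_comb.
  congr pair; rewrite f_comb //; case: (f x) (f y) => [a b] [c d] /=.
  by rewrite mul0r subr0.
- exact: le_trans (Re_le _) (f_le Mx).
Qed.

Let graph_max : exists2 G, dom_graph G & forall H, dom_graph H -> G `<=` H -> H `<=` G.
Proof.
have [F FP Ftot|G [GP Gmax]] := @Zorn_bigcup _ [set G | G = set0 \/ dom_graph G].
  have [[G FG Gdom]|nF] := pselect (exists2 G, F G & dom_graph G); last first.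
    left; apply/seteqP; split => // a [G FG Ga]; have [G0|Gd] := FP _ FG.
      by rewrite G0 in Ga.
    by case: nF; exists G.
  right; split.
  - by move=> x Mx; exists G => //; case: Gdom => h _ _; exact: h.
  - move=> r a b [A FA Aa] [B FB Bb].
    have comb H : F H -> H a -> H b ->
        (\bigcup_(X in F) X) (r%:C *: a.1 + b.1, r * a.2 + b.2).
      move=> FH Ha Hb; exists H => //; have [H0|[_ h _]] := FP _ FH.
        by rewrite H0 in Ha.
      exact: h.
    have [AB|BA] := Ftot _ _ FA FB; first by apply: (comb B) => //; exact: AB.
    by apply: (comb A) => //; exact: BA.
  - move=> a [A FA Aa]; have [A0|[_ _ h]] := FP _ FA; last exact: h.
    by rewrite A0 in Aa.
have Gd : dom_graph G.
  case: GP => // G0; case: (Gmax [set (x, complex.Re (f x)) | x in M]).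
    rewrite G0; split=> // h.
    by apply: (h (0, complex.Re (f 0))); exists 0.
  by right.
exists G => // H Hd GH; apply: contrapT => HG.
by apply: (Gmax H); [split|right].
Qed.

Let graph_total G : dom_graph G -> (forall H, dom_graph H -> G `<=` H -> H `<=` G) ->
  forall v, exists r, G (v, r).
Proof.
move=> [Gf Gc Gle] Gmax v.
have G0 : G (0, 0).
  have := Gc (-1) _ _ (Gf _ M0) (Gf _ M0); rewrite /= rmorphN1 scaleN1r addNr.
  by rewrite mulN1r addNr.
have [c c1 c2] : exists2 c, forall a, G a -> a.2 - rnorm (a.1 - v) <= c &
    forall a, G a -> a.2 + c <= rnorm (a.1 + v).
  have ub a b : G a -> G b -> a.2 - rnorm (a.1 - v) <= rnorm (b.1 + v) - b.2.
    move=> Ga Gb; rewrite lerBlDr addrAC lerBrDr.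
    have := Gle _ (Gc 1 _ _ Ga Gb); rewrite /= scale1r mul1r => /le_trans; apply.
    have -> : a.1 + b.1 = (b.1 + v) + (a.1 - v).
      by rewrite addrACA subrr addr0 addrC.
    exact: rnormD.
  pose S := [set a.2 - rnorm (a.1 - v) | a in G].
  exists (sup S) => a Ga.
    apply: ub_le_sup; last by exists a.
    by exists (rnorm (0 + v) - 0) => _ [b Gb <-]; exact: (ub b (0, 0)).
  rewrite -lerBrDl; apply: ge_sup; first by exists (0 - rnorm (0 - v)), (0, 0).
  by move=> _ [b Gb <-]; exact: ub.
pose H := [set p | exists a t, G a /\ p = (a.1 + t%:C *: v, a.2 + t * c)].
have GH : G `<=` H.
  move=> [x r] Ga; exists (x, r), 0; split => //=.
  by rewrite scale0r mul0r !addr0.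
have Hd : dom_graph H.
  split.
  - by move=> x Mx; apply/GH/Gf.
  - move=> r _ _ [a [s [Ga ->]]] [b [t [Gb ->]]] /=.
    exists (r%:C *: a.1 + b.1, r * a.2 + b.2), (r * s + t).
    split; first exact: Gc.
    congr pair => /=; last by rewrite mulrDr mulrDl mulrA addrACA.
    by rewrite rmorphD rmorphM /= scalerDl scalerDr scalerA addrACA.
  - move=> _ [a [t [Ga ->]]] /=; have [t0|t0|->] := ltgtP t 0; last first.
    + by rewrite scale0r mul0r !addr0; exact: Gle.
    + have := c2 _ (Gc t^-1 _ _ Ga G0); rewrite /= !addr0 => h.
      have -> : a.1 + t%:C *: v = t%:C *: ((t^-1)%:C *: a.1 + v).
        by rewrite scalerDr scalerA -rmorphM /= divff ?gt_eqF // scale1r.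
      rewrite rnormZ rnorm_real gtr0_norm // -ler_pdivrMl // mulrDr mulKf //.
      by rewrite gt_eqF.
    + have := c1 _ (Gc (- t)^-1 _ _ Ga G0); rewrite /= !addr0 => h.
      have nt0 : 0 < - t by rewrite oppr_gt0.
      have -> : a.1 + t%:C *: v = (- t)%:C *: (((- t)^-1)%:C *: a.1 - v).
        rewrite scalerBr scalerA -rmorphM /= divff ?gt_eqF // scale1r.
        by rewrite rmorphN scaleNr opprK.
      rewrite rnormZ rnorm_real gtr0_norm // -ler_pdivrMl // mulrDr.
      rewrite -[t in t * c]opprK mulNr mulrN mulKf ?gt_eqF //.
      by rewrite lerBlDr addrC -lerBlDr.
exists c; apply: (Gmax H) => //.
exists (0, 0), 1; split => //=.
by rewrite scale1r mul1r !add0r.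
Qed.

Theorem hahn_banach : exists F : {scalar V},
  (forall x, rnorm (F x) <= rnorm x) /\ (forall x, M x -> F x = f x).
Proof.
have [G Gd Gmax] := graph_max.
have /choice[U GU] := graph_total Gd Gmax.
have [Gf Gc Gle] := Gd.
have Gfun x r s : G (x, r) -> G (x, s) -> r = s.
  have le r' s' : G (x, r') -> G (x, s') -> s' <= r'.
    move=> Gr Gs; have := Gle _ (Gc (-1) _ _ Gr Gs).
    by rewrite /= rmorphN1 scaleN1r addNr rnorm0 mulN1r addrC subr_le0.
  by move=> Gr Gs; apply/le_anti; rewrite !le.
have UD r x y : U (r%:C *: x + y) = r * U x + U y.
  exact: Gfun (GU _) (Gc r _ _ (GU x) (GU y)).
have U0 : U 0 = 0 by have := UD (-1) 0 0; rewrite scaler0 addr0 mulN1r addNr.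
pose F x : C := U x -i* U ('i%C *: x).
have F_lin : linear_for *%R F.
  move=> [a b] x y; rewrite /F.
  have -> : (a +i* b : C) *: x + y = a%:C *: x + (b%:C *: ('i%C *: x) + y).
    rewrite addrA scalerA -scalerDl; congr (_ *: _ + _).
    apply/eqP; rewrite eq_complex /=.
    by rewrite !(mul0r, mulr0, mulr1, subr0, add0r, addr0) !eqxx.
  have -> : 'i%C *: (a%:C *: x + (b%:C *: ('i%C *: x) + y)) =
     a%:C *: ('i%C *: x) + ((- b)%:C *: x + 'i%C *: y).
    rewrite !scalerDr !scalerA; congr (_ *: _ + (_ *: _ + _)).
      exact: mulrC.
    apply/eqP; rewrite eq_complex /=.
    by rewrite !(mul0r, mulr0, mulr1, mul1r, add0r, addr0, sub0r, oppr0) !eqxx.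
  rewrite !UD; apply/eqP; rewrite eq_complex /=.
  apply/andP; split; apply/eqP; first by rewrite mulrN opprK addrA.
  by rewrite mulNr !opprD opprK mulrN addrA.
pose FM := GRing.isLinear.Build C V C *%R F F_lin.
pose Flin : {scalar V} := HB.pack F FM.
exists Flin; split=> x /=.
  have [F0|Fx0] := eqVneq (F x) 0; first by rewrite /= F0 rnorm0 rnorm_ge0.
  have nF : 0 < rnorm (F x).
    by rewrite lt_neqAle rnorm_ge0 andbT eq_sym; apply: contra_neq Fx0 => /rnorm_eq0.
  pose u : C := (rnorm (F x))^-1%:C * (F x)^*%C.
  have nu : rnorm u = 1.
    rewrite /u rnormM rnorm_real gtr0_norm ?invr_gt0 //.
    by rewrite {2}/rnorm normcJ -/(rnorm _) mulVf // gt_eqF.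
  have Fu : F (u *: x) = (rnorm (F x))%:C.
    have := F_lin u x 0; rewrite addr0 => ->.
    have -> : F 0 = 0 by rewrite /F scaler0 U0 oppr0.
    rewrite addr0 /u -mulrA [_^*%C * _]mulrC -sqr_normc rnormE -rmorphXn -rmorphM.
    by rewrite /= expr2 mulKf // gt_eqF.
  have -> : rnorm (F x) = U (u *: x) by case: Fu.
  apply: le_trans (Gle _ (GU (u *: x))) _.
  by rewrite /= rnormZ nu mul1r.
move=> Mx.
have fi : f ('i%C *: x) = 'i%C * f x.
  have := f_comb 'i%C Mx M0; rewrite addr0 => ->.
  have := f_comb (-1) M0 M0; rewrite scaleN1r oppr0 addr0 mulN1r addNr => ->.
  by rewrite addr0.
have Mix : M ('i%C *: x) by rewrite -[_ *: _]addr0; exact: M_comb.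
rewrite /F (Gfun _ _ _ (GU x) (Gf _ Mx)) (Gfun _ _ _ (GU _) (Gf _ Mix)) fi.
by case: (f x) => a b /=; rewrite mul0r mul1r sub0r opprK.
Qed.

End HahnBanach.

Lemma norming_functional (R : realType) (V : normedModType R[i]) (x : V) :
  exists F : {scalar V}, (forall y, rnorm (F y) <= rnorm y) /\ F x = `|x|.
Proof.
have [->|x0] := eqVneq x 0.
  have [||||F [F1 _]] := @hahn_banach R V [set 0] (fun=> 0).
  - by [].
  - by move=> c y z /= -> ->; rewrite scaler0 addr0.
  - by move=> c y z _ _; rewrite mulr0 addr0.
  - by move=> y _; rewrite rnorm0 rnorm_ge0.
  by exists F; split=> //; rewrite linear0 normr0.
pose M := [set c *: x | c in [set: R[i]]].
have /choice[k hk] (y : V) : exists c : R[i], M y -> y = c *: x.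
  have [[c _ cy]|nM] := pselect (M y); first by exists c.
  by exists 0 => /nM.
have kx c : k (c *: x) = c.
  have /eqP : c *: x = k (c *: x) *: x by apply: hk; exists c.
  by rewrite -subr_eq0 -scalerBl scaler_eq0 (negbTE x0) orbF subr_eq0 => /eqP.
have [||||F [F1 F2]] := @hahn_banach R V M (fun y => k y * `|x|).
- by exists 0 => //; rewrite scale0r.
- move=> c _ _ [a _ <-] [b _ <-]; exists (c * a + b) => //.
  by rewrite scalerDl scalerA.
- move=> c _ _ [a _ <-] [b _ <-].
  by rewrite scalerA -scalerDl !kx mulrDl mulrA.
- move=> _ [a _ <-]; rewrite kx rnormM rnormZ [`|x|]rnormE rnorm_real.
  by rewrite ger0_norm // rnorm_ge0.
exists F; split => //; rewrite -[in LHS](scale1r x) F2; last by exists 1.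
by rewrite kx mul1r.
Qed.

(* The algebraic tensor product of [X] and [Z], realized as the span of the
   evaluations [b |-> b x z] inside the dual of the space of all (not
   necessarily bounded) bilinear forms on [X * Z].  Two sums of elementary
   tensors are equal iff every bilinear form agrees on them, which over a field
   is the usual equality of tensors. *)
Section Tensor.
Variables (K : fieldType) (X Z : lmodType K).

Definition bilform := {bilinear X -> Z -> K | *%R & *%R}.

Definition tens_eval (s : seq (X * Z)) : bilform -> K^o :=
  fun b => \sum_(p <- s) b p.1 p.2.

Definition tens_pred : {pred bilform -> K^o} :=
  [pred u | `[< exists s, u = tens_eval s >]].

Fact tens_submod : submod_closed tens_pred.
Proof.
split=> [|c u v /asboolP[s ->] /asboolP[t ->]]; apply/asboolP.
  by exists [::]; apply/funext => b; rewrite /tens_eval big_nil.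
exists ([seq (c *: p.1, p.2) | p <- s] ++ t); apply/funext => b.
rewrite /tens_eval big_cat big_map /=; congr (_ + _).
rewrite [LHS]mulr_sumr; apply: eq_bigr => p _.
by rewrite linearZl_LR.
Qed.
HB.instance Definition _ :=
  GRing.isSubmodClosed.Build K (bilform -> K^o) tens_pred tens_submod.

Record tens := Tens { tens_val :> bilform -> K^o ; _ : tens_val \in tens_pred }.
HB.instance Definition _ := [isSub for tens_val].
HB.instance Definition _ := [Choice of tens by <:].
HB.instance Definition _ := [SubChoice_isSubLmodule of tens by <:].

Lemma tens_ext (u v : tens) : (forall b, u b = v b) -> u = v.
Proof. by move=> h; apply/val_inj/funext. Qed.

Lemma tens_valD (u v : tens) b : (u + v) b = u b + v b. Proof. by []. Qed.
Lemma tens_valZ c (u : tens) b : (c *: u) b = c * u b. Proof. by []. Qed.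
Lemma tens_val0 b : (0 : tens) b = 0. Proof. by []. Qed.
Lemma tens_valN (u : tens) b : (- u) b = - u b. Proof. by []. Qed.
Lemma tens_val_sum I (s : seq I) (F : I -> tens) b :
  (\sum_(i <- s) F i) b = \sum_(i <- s) F i b.
Proof.
elim: s => [|i s IHs]; first by rewrite !big_nil.
by rewrite !big_cons tens_valD IHs.
Qed.

Fact tensor_subproof (x : X) (z : Z) : (fun b : bilform => b x z : K^o) \in tens_pred.
Proof.
apply/asboolP; exists [:: (x, z)]; apply/funext => b.
by rewrite /tens_eval big_seq1.
Qed.
Definition tensor (x : X) (z : Z) : tens := Tens (tensor_subproof x z).

Lemma tensorE x z b : tensor x z b = b x z. Proof. by []. Qed.

Lemma tensor_linearl z : linear (tensor^~ z).
Proof. by move=> c x y; apply: tens_ext => b; rewrite tensorE linearPl. Qed.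

Lemma tensor_linearr x : linear (tensor x).
Proof. by move=> c z t; apply: tens_ext => b; rewrite tensorE linearPr. Qed.

Lemma tens_span (u : tens) :
  exists s : seq (X * Z), u = \sum_(p <- s) tensor p.1 p.2.
Proof.
case: u => u uP; have /asboolP[s us] := uP; exists s; apply: tens_ext => b.
by rewrite tens_val_sum /= us.
Qed.

End Tensor.

Section TensorMap.
Variables (K : fieldType) (X Y Z T : lmodType K).
Variables (f : {linear X -> Y}) (g : {linear Z -> T}).

Definition bilform_comp (b : bilform Y T) : X -> Z -> K := fun x z => b (f x) (g z).

Fact bilform_comp_bilinear b : bilinear_for *%R *%R (bilform_comp b).
Proof.
split=> [z c x y|x c z t]; rewrite /bilform_comp linearP ?linearPl //.
by rewrite linearPr.
Qed.
HB.instance Definition _ b :=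
  bilinear_isBilinear.Build K X Z K *%R *%R (bilform_comp b)
    (bilform_comp_bilinear b).

Fact tens_map_subproof (u : tens X Z) :
  (fun b : bilform Y T => u (bilform_comp b) : K^o) \in @tens_pred K Y T.
Proof.
have [s ->] := tens_span u; apply/asboolP.
exists [seq (f p.1, g p.2) | p <- s]; apply/funext => b.
by rewrite tens_val_sum /tens_eval big_map.
Qed.
Definition tens_map (u : tens X Z) : tens Y T := Tens (tens_map_subproof u).

Fact tens_map_linear : linear tens_map.
Proof. by move=> c u v; apply: tens_ext. Qed.
HB.instance Definition _ := GRing.isLinear.Build K (tens X Z) (tens Y T) *:%R
  tens_map tens_map_linear.

Lemma tens_map_tensor x z : tens_map (tensor x z) = tensor (f x) (g z).
Proof. exact: tens_ext. Qed.

End TensorMap.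

Section ProdForm.
Variables (K : fieldType) (X Z : lmodType K) (f : {scalar X}) (g : {scalar Z}).

Definition prod_form (x : X) (z : Z) : K := f x * g z.

Fact prod_form_bilinear : bilinear_for *%R *%R prod_form.
Proof.
split=> [z c x y|x c z t]; rewrite /prod_form linearP /=.
  by rewrite mulrDl mulrA.
by rewrite mulrDr mulrCA.
Qed.
HB.instance Definition _ :=
  bilinear_isBilinear.Build K X Z K *%R *%R prod_form prod_form_bilinear.

End ProdForm.

Definition dual_ball (R : realType) (V : normedModType R[i]) : set {scalar V} :=
  [set f | forall x, rnorm (f x) <= rnorm x].
Arguments dual_ball {R} V.

Section TensorNorms.
Variables (R : realType) (X Z : normedModType R[i]).
Local Notation C := R[i].
Implicit Types u v : tens X Z.

Definition tens_repr u : set (seq (X * Z)) :=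
  [set s | u = \sum_(p <- s) tensor p.1 p.2].

Definition proj_norm u : R :=
  inf [set \sum_(p <- s) rnorm p.1 * rnorm p.2 | s in tens_repr u].

(* [u (prod_form f g)] is the value of [f (x) g] at [u]. *)
Definition inj_norm u : R :=
  sup [set rnorm (u (prod_form fg.1 fg.2)) |
        fg in dual_ball X `*` dual_ball Z].

Let zero_dual (V : normedModType C) : dual_ball V \0.
Proof. by move=> x; rewrite /= rnorm0 rnorm_ge0. Qed.

Let eval_le u s f g : tens_repr u s -> dual_ball X f -> dual_ball Z g ->
  rnorm (u (prod_form f g)) <= \sum_(p <- s) rnorm p.1 * rnorm p.2.
Proof.
move=> -> hf hg; rewrite tens_val_sum (le_trans (rnorm_sum _ _)) //.
by apply: ler_sum => p _; rewrite rnormM ler_pM ?rnorm_ge0 // ?hf ?hg.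
Qed.

Lemma inj_norm_ub u f g : dual_ball X f -> dual_ball Z g ->
  rnorm (u (prod_form f g)) <= inj_norm u.
Proof.
move=> hf hg; apply: ub_le_sup; last by exists (f, g).
have [s us] := tens_span u.
exists (\sum_(p <- s) rnorm p.1 * rnorm p.2) => _ [[f' g'] [/= hf' hg'] <-].
exact: eval_le.
Qed.

Lemma inj_norm_le u (r : R) :
  (forall f g, dual_ball X f -> dual_ball Z g -> rnorm (u (prod_form f g)) <= r) ->
  inj_norm u <= r.
Proof.
move=> h; apply: ge_sup; last by move=> _ [[f g] [/= hf hg] <-]; exact: h.
exists (rnorm (u (prod_form (\0 : {scalar X}) (\0 : {scalar Z})))).
by exists (\0 : {scalar X}, \0 : {scalar Z}) => //; split; exact: zero_dual.
Qed.

Let repr_has_inf u :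
  has_inf [set \sum_(p <- s) rnorm p.1 * rnorm p.2 | s in tens_repr u].
Proof.
split; first by have [s us] := tens_span u; eexists; exists s.
exists 0 => _ [s _ <-]; apply: sumr_ge0 => p _.
by rewrite mulr_ge0 ?rnorm_ge0.
Qed.

Lemma proj_norm_lb u s : tens_repr u s ->
  proj_norm u <= \sum_(p <- s) rnorm p.1 * rnorm p.2.
Proof. by move=> us; apply: ge_inf; [case: (repr_has_inf u)|exists s]. Qed.

Lemma proj_norm_ge u (r : R) :
  (forall s, tens_repr u s -> r <= \sum_(p <- s) rnorm p.1 * rnorm p.2) ->
  r <= proj_norm u.
Proof.
move=> h; apply: lb_le_inf; first by case: (repr_has_inf u).
by move=> _ [s us <-]; exact: h.
Qed.

Lemma proj_norm_ex u (e : R) : proj_norm u < e ->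
  exists2 s, tens_repr u s & \sum_(p <- s) rnorm p.1 * rnorm p.2 < e.
Proof.
move=> ue; have [_ [s us <-] se] := inf_lt (repr_has_inf u).1 ue.
by exists s.
Qed.

Lemma inj_le_proj_norm u : inj_norm u <= proj_norm u.
Proof.
apply: proj_norm_ge => s us; apply: inj_norm_le => f g hf hg.
exact: eval_le.
Qed.

Let dual_separates (s : seq (X * Z)) :
  (forall f g, dual_ball X f -> dual_ball Z g ->
     \sum_(p <- s) f p.1 * g p.2 = 0) ->
  forall b : bilform X Z, \sum_(p <- s) b p.1 p.2 = 0.
Proof.
have [n] := ubnP (size s); elim: n s => // n IHn [|[x z] s] /=.
  by move=> _ _ b; rewrite big_nil.
rewrite ltnS => sn h b; have [z0|z0] := eqVneq z 0.
  rewrite big_cons /= z0 linear0r add0r; apply: IHn => // f g hf hg.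
  by have := h f g hf hg; rewrite big_cons /= z0 linear0 mulr0 add0r.
have [g [hg gz]] := norming_functional z.
have gz0 : g z != 0 by rewrite gz normr_eq0.
pose k t := g t / g z.
have xE : x = - \sum_(p <- s) k p.2 *: p.1.
  have sum0 : \sum_(p <- (x, z) :: s) g p.2 *: p.1 = 0.
    have [f [hf fn]] := norming_functional (\sum_(p <- (x, z) :: s) g p.2 *: p.1).
    apply/eqP; rewrite -normr_eq0 -fn linear_sum /= -[X in _ == X](h f g hf hg).
    by apply/eqP/eq_bigr => p _; rewrite linearZ /= mulrC.
  move: sum0; rewrite big_cons /= => /(congr1 ( *:%R (g z)^-1)).
  rewrite scaler0 scalerDr scalerA mulVf // scale1r => /eqP.
  rewrite addr_eq0 => /eqP ->; congr (- _); rewrite scaler_sumr.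
  by apply: eq_bigr => p _; rewrite scalerA mulrC.
pose s' := [seq (p.1, p.2 - k p.2 *: z) | p <- s].
have s'E (c : bilform X Z) :
    \sum_(p <- s') c p.1 p.2 = \sum_(p <- (x, z) :: s) c p.1 p.2.
  rewrite big_map big_cons /= {1}xE linearNl linear_sumlz -sumrN -big_split /=.
  by apply: eq_bigr => p _; rewrite linearBr linearZl_LR linearZr_LR addrC.
rewrite -s'E; apply: IHn; first by rewrite size_map.
by move=> f g' hf hg'; rewrite (s'E (prod_form f g')) h.
Qed.

Lemma inj_norm0_eq0 u : inj_norm u = 0 -> u = 0.
Proof.
move=> u0; have [s us] := tens_span u; apply: tens_ext => b.
rewrite us tens_val_sum; apply: dual_separates => f g hf hg.
apply: rnorm_eq0; apply/le_anti; rewrite rnorm_ge0 andbT -u0.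
by have := inj_norm_ub u hf hg; rewrite {1}us tens_val_sum.
Qed.

Lemma inj_normD u v : inj_norm (u + v) <= inj_norm u + inj_norm v.
Proof.
apply: inj_norm_le => f g hf hg; rewrite tens_valD (le_trans (rnormD _ _)) //.
by apply: lerD; exact: inj_norm_ub.
Qed.

Let scale_le (N : tens X Z -> R) : (forall u, 0 <= N u) ->
  (forall c u, N (c *: u) <= rnorm c * N u) ->
  forall c u, N (c *: u) = rnorm c * N u.
Proof.
move=> N0 le c u; apply/le_anti; rewrite le /=; have [->|c0] := eqVneq c 0.
  by rewrite rnorm0 mul0r.
have := ler_wpM2l (rnorm_ge0 c) (le c^-1 (c *: u)).
rewrite scalerA mulVf // scale1r mulrA -rnormM divff //.
suff -> : rnorm (1 : C) = 1 by rewrite mul1r.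
by rewrite /rnorm normr1.
Qed.

Let inj_norm_ge0 u : 0 <= inj_norm u.
Proof.
apply: le_trans (rnorm_ge0 (u (prod_form (\0 : {scalar X}) (\0 : {scalar Z})))) _.
by apply: inj_norm_ub; exact: zero_dual.
Qed.

Lemma inj_normZ c u : inj_norm (c *: u) = rnorm c * inj_norm u.
Proof.
apply: scale_le c u => // c u; apply: inj_norm_le => f g hf hg.
by rewrite tens_valZ rnormM ler_wpM2l ?rnorm_ge0 // inj_norm_ub.
Qed.

Lemma proj_normD u v : proj_norm (u + v) <= proj_norm u + proj_norm v.
Proof.
apply/ler_addgt0Pr => e e0; have e2 : 0 < e / 2 by rewrite divr_gt0.
have [s us hs] : exists2 s, tens_repr u s &
    \sum_(p <- s) rnorm p.1 * rnorm p.2 < proj_norm u + e / 2.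
  by apply: proj_norm_ex; rewrite ltrDl.
have [t vt ht] : exists2 t, tens_repr v t &
    \sum_(p <- t) rnorm p.1 * rnorm p.2 < proj_norm v + e / 2.
  by apply: proj_norm_ex; rewrite ltrDl.
have uvst : tens_repr (u + v) (s ++ t).
  by rewrite /tens_repr /= big_cat /= -us -vt.
rewrite (le_trans (proj_norm_lb uvst)) // big_cat /= [e in leRHS]splitr addrACA.
by rewrite lerD // ltW.
Qed.

Lemma proj_normZ c u : proj_norm (c *: u) = rnorm c * proj_norm u.
Proof.
apply: scale_le c u => [u|c u]; first exact: le_trans (inj_le_proj_norm u).
have [s0 us0] := tens_span u.
have key s : tens_repr u s ->
    proj_norm (c *: u) <= rnorm c * \sum_(p <- s) rnorm p.1 * rnorm p.2.
  move=> us; have cus : tens_repr (c *: u) [seq (c *: p.1, p.2) | p <- s].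
    rewrite /tens_repr /= us big_map scaler_sumr; apply: eq_bigr => p _ /=.
    by apply: tens_ext => b; rewrite tens_valZ !tensorE linearZl_LR.
  rewrite (le_trans (proj_norm_lb cus)) // big_map mulr_sumr.
  by apply: ler_sum => p _ /=; rewrite rnormZ mulrA.
have [c0|c0] := eqVneq c 0; first by have := key _ us0; rewrite c0 rnorm0 !mul0r.
have cp : 0 < rnorm c.
  by rewrite lt_neqAle rnorm_ge0 andbT eq_sym; apply: contra_neq c0 => /rnorm_eq0.
rewrite -ler_pdivrMl //; apply: proj_norm_ge => s us.
by rewrite ler_pdivrMl // key.
Qed.

Lemma proj_norm0_eq0 u : proj_norm u = 0 -> u = 0.
Proof.
move=> u0; apply: inj_norm0_eq0; apply/le_anti.
by rewrite inj_norm_ge0 andbT -u0 inj_le_proj_norm.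
Qed.

End TensorNorms.

Definition ptens (R : realType) (X Z : normedModType R[i]) : Type := tens X Z.
HB.instance Definition _ (R : realType) (X Z : normedModType R[i]) :=
  GRing.Lmodule.on (ptens X Z).
HB.instance Definition _ (R : realType) (X Z : normedModType R[i]) :=
  Lmodule_hasRealNorm.Build R (ptens X Z)
    (@proj_normD R X Z) (@proj_normZ R X Z) (@proj_norm0_eq0 R X Z).

Definition itens (R : realType) (X Z : normedModType R[i]) : Type := tens X Z.
HB.instance Definition _ (R : realType) (X Z : normedModType R[i]) :=
  GRing.Lmodule.on (itens X Z).
HB.instance Definition _ (R : realType) (X Z : normedModType R[i]) :=
  Lmodule_hasRealNorm.Build R (itens X Z)
    (@inj_normD R X Z) (@inj_normZ R X Z) (@inj_norm0_eq0 R X Z).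

Lemma rnorm_ptens (R : realType) (X Z : normedModType R[i]) (u : ptens X Z) :
  rnorm u = proj_norm u.
Proof. by []. Qed.

Lemma rnorm_itens (R : realType) (X Z : normedModType R[i]) (u : itens X Z) :
  rnorm u = inj_norm u.
Proof. by []. Qed.

Section TensorMapOnNormed.
Variables (R : realType) (X Y Z T : normedModType R[i]).
Variables (f : {linear X -> Y}) (g : {linear Z -> T}).

Definition ptens_map : ptens X Z -> ptens Y T := tens_map f g.
Fact ptens_map_linear : linear ptens_map. Proof. exact: tens_map_linear. Qed.
HB.instance Definition _ :=
  GRing.isLinear.Build R[i] (ptens X Z) (ptens Y T) *:%R ptens_map ptens_map_linear.

Definition itens_map : itens X Z -> itens Y T := tens_map f g.
Fact itens_map_linear : linear itens_map. Proof. exact: tens_map_linear. Qed.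
HB.instance Definition _ :=
  GRing.isLinear.Build R[i] (itens X Z) (itens Y T) *:%R itens_map itens_map_linear.

End TensorMapOnNormed.

Definition isometric (R : realType) (X Y : normedZmodType R[i]) (f : X -> Y) :=
  forall x, `|f x| = `|x|.

Section C0ModuleTheory.
Variable R : realType.
Local Notation C := R[i].

Section ActLinear.
Variables (X : normedC0Module R) (a : c0 R).
Fact c0act_linear : linear (@c0act R X a).
Proof. by move=> c x y; rewrite c0actDr c0actZr. Qed.
HB.instance Definition _ :=
  GRing.isLinear.Build C X X *:%R (@c0act R X a) c0act_linear.
End ActLinear.

Definition is_c0_morphism (X Y : normedC0Module R) (f : X -> Y) :=
  forall a x, f (c0act a x) = c0act a (f x).

Section InjModule.
Variables (X : normedC0Module R) (E : normedModType C).
Local Notation T := (itens X E).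

Definition itens_act (a : c0 R) (u : T) : T :=
  tens_map (c0act a : {linear X -> X}) (idfun : {linear E -> E}) u.

Lemma itens_act_tensor a x e : itens_act a (tensor x e) = tensor (c0act a x) e.
Proof. exact: tens_map_tensor. Qed.

Let actDr a : {morph itens_act a : u v / u + v}.
Proof. by move=> u v; exact: linearD. Qed.
Let actZr (c : C) a u : itens_act a (c *: u) = c *: itens_act a u.
Proof. exact: linearZ. Qed.

Let act_sum a (s : seq (X * E)) :
  itens_act a (\sum_(p <- s) tensor p.1 p.2 : tens X E) =
  \sum_(p <- s) tensor (c0act a p.1) p.2 :> tens X E.
Proof.
rewrite [LHS]linear_sum /=; apply: eq_bigr => p _; exact: tens_map_tensor.
Qed.

Let actDl a b u : itens_act (a + b) u = itens_act a u + itens_act b u.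
Proof.
have [s ->] := tens_span u; rewrite !act_sum -[RHS]big_split /=.
apply: eq_bigr => p _; rewrite c0actDl; apply: tens_ext => l.
by rewrite tens_valD !tensorE linearDl.
Qed.

Let actZl (c : C) a u : itens_act (c *: a) u = c *: itens_act a u.
Proof.
have [s ->] := tens_span u; rewrite !act_sum [RHS]scaler_sumr.
apply: eq_bigr => p _; rewrite c0actZl; apply: tens_ext => l.
by rewrite tens_valZ !tensorE linearZl_LR.
Qed.

Let actA a b u : itens_act a (itens_act b u) = itens_act (c0_mul a b) u.
Proof.
have [s ->] := tens_span u; rewrite !act_sum [LHS]linear_sum /=.
by apply: eq_bigr => p _; rewrite tens_map_tensor /= c0actA.
Qed.

Let act_norm a u : `|itens_act a u| <= `|a| * `|u|.
Proof.
rewrite !rnormE -rmorphM lecR; apply: inj_norm_le => f g hf hg.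
have ha (x : X) : rnorm (c0act a x) <= rnorm a * rnorm x.
  by rewrite -lecR rmorphM /= -!rnormE c0act_norm.
have [a0|a0] := eqVneq (rnorm a) 0.
  have act0 (x : X) : c0act a x = 0.
    apply: rnorm_eq0; apply/le_anti; rewrite rnorm_ge0 andbT.
    by rewrite (le_trans (ha x)) // a0 mul0r.
  have -> : itens_act a u = 0.
    have [s ->] := tens_span u; rewrite act_sum big1 // => p _.
    by rewrite act0; apply: tens_ext => b; rewrite tensorE linear0l.
  by rewrite tens_val0 rnorm0 a0 mul0r.
have ap : 0 < rnorm a by rewrite lt_neqAle eq_sym a0 rnorm_ge0.
pose F (x : X) : C := (rnorm a)^-1%:C * f (c0act a x).
have F_lin : linear_for *%R F.
  by move=> c x y; rewrite /F c0actDr c0actZr linearP mulrDr mulrCA.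
pose FM := GRing.isLinear.Build C X C *%R F F_lin.
pose f' : {scalar X} := HB.pack F FM.
have hf' : dual_ball X f'.
  move=> x; rewrite /= rnormM rnorm_real gtr0_norm ?invr_gt0 //.
  by rewrite ler_pdivrMl // (le_trans (hf _)).
rewrite -ler_pdivrMl //; apply: le_trans (inj_norm_ub u hf' hg).
rewrite -[X in X * _]gtr0_norm ?invr_gt0 // -rnorm_real -rnormM.
have [s ->] := tens_span u; rewrite act_sum !tens_val_sum mulr_sumr.
rewrite le_eqVlt; apply/orP; left; apply/eqP; congr rnorm.
by apply: eq_bigr => p _; rewrite !tensorE /= /prod_form /= mulrA.
Qed.

HB.instance Definition _ :=
  isC0Module.Build R T actDl actZl actDr actZr actA act_norm.

Lemma itens_actE (a : c0 R) (u : T) : c0act a u = itens_act a u.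
Proof. by []. Qed.

End InjModule.

Section ModuleTensor.
Variables (X Z : normedC0Module R).

Definition c0_relations : set (ptens X Z) :=
  [set u | exists a x z, u = tensor (c0act a x) z - tensor x (c0act a z)].

Definition ctens := nquot (closed_span c0_relations).
HB.instance Definition _ := NormedModule.on ctens.

Definition ctens_pi (u : ptens X Z) : ctens := nquot_pi (closed_span c0_relations) u.
Definition ctensor (x : X) (z : Z) : ctens := ctens_pi (tensor x z).

End ModuleTensor.
Arguments c0_relations X Z : clear implicits.

(* The induced map is computed on a representative; for a bounded morphism
   [ctens_mapE] shows that the choice does not matter. *)
Definition ctens_map (X Y Z : normedC0Module R) (f : {linear X -> Y})
    (u : ctens X Z) : ctens Y Z :=
  ctens_pi (ptens_map f (idfun : {linear Z -> Z}) (repr u)).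
Arguments ctens_map {X Y} Z f u.

Section ModuleTensorMap.
Variables (X Y Z : normedC0Module R) (f : {linear X -> Y}).
Hypothesis f_morph : is_c0_morphism f.
Hypothesis f_bounded : exists M : R, forall x, rnorm (f x) <= M * rnorm x.

Lemma ctens_mapE (u : ptens X Z) :
  ctens_map Z f (ctens_pi u) = ctens_pi (ptens_map f (idfun : {linear Z -> Z}) u).
Proof.
apply/nquot_piP; rewrite -linearB.
have : repr (ctens_pi u) - u \in subspace_pred (closed_span (c0_relations X Z)).
  by apply/nquot_piP; rewrite nquot_piK.
move: (_ - u) => v /asboolP/closure_rnormP vS.
apply/asboolP/closure_rnormP => e e0.
have [M hM] := f_bounded; pose N := `|M| + 1.
have N0 : 0 < N by rewrite ltr_wpDl.
have hN x : rnorm (f x) <= N * rnorm x.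
  apply: le_trans (hM x) _; rewrite ler_wpM2r ?rnorm_ge0 //.
  by rewrite (le_trans (ler_norm M)) // lerDl.
have [w [s [sS ->]] vw] := vS _ (divr_gt0 e0 N0).
exists (ptens_map f (idfun : {linear Z -> Z}) (\sum_(p <- s) p.1 *: p.2)).
  exists [seq (p.1, ptens_map f (idfun : {linear Z -> Z}) p.2) | p <- s].
  split=> [_ /mapP[p ps ->]|] /=.
    have [a [x [z ->]]] := sS p ps; exists a, (f x), z.
    by rewrite [LHS]linearB /= /ptens_map !tens_map_tensor /= f_morph.
  by rewrite linear_sum big_map; apply: eq_bigr => p _; rewrite linearZ.
rewrite -linearB; move: vw; rewrite ltr_pdivlMr //; apply: le_lt_trans.
move: (v - _) => t; rewrite mulrC -ler_pdivrMl //; apply: proj_norm_ge => r tr.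
have ftr : tens_repr (ptens_map f (idfun : {linear Z -> Z}) t)
    [seq (f p.1, p.2) | p <- r].
  rewrite /tens_repr /= tr [LHS]linear_sum big_map.
  by apply: eq_bigr => p _; exact: tens_map_tensor.
rewrite ler_pdivrMl // (le_trans (proj_norm_lb ftr)) // big_map mulr_sumr.
by apply: ler_sum => p _ /=; rewrite mulrA ler_wpM2r ?rnorm_ge0.
Qed.

Lemma ctens_map_tensor x z : ctens_map Z f (ctensor x z) = ctensor (f x) z.
Proof. by rewrite ctens_mapE /ptens_map tens_map_tensor. Qed.

End ModuleTensorMap.

Definition homogeneous (X : normedC0Module R) :=
  forall x y : X, (forall n, `|c0act (pn n) x| = `|c0act (pn n) y|) -> `|x| = `|y|.

Definition extremely_flat (K : normedC0Module R -> Prop) (Z : normedC0Module R) :=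
  forall (X Y : normedC0Module R) (j : {linear X -> Y}), K X -> K Y ->
    is_c0_morphism j -> isometric j -> isometric (ctens_map Z j).

End C0ModuleTheory.
Arguments ctens_map {R X Y} Z f u.

(* Main.v *)
Require Import Defs.
From HB Require Import structures.
From mathcomp Require Import all_boot all_order all_algebra.
From mathcomp Require Import all_classical all_reals all_analysis.
From mathcomp Require Import complex ring lra.

Set Implicit Arguments.
Unset Strict Implicit.
Unset Printing Implicit Defensive.

Import Order.TTheory GRing.Theory Num.Theory.
Import numFieldNormedType.Exports.

Local Open Scope classical_set_scope.
Local Open Scope ring_scope.
Local Open Scope complex_scope.

(** Write [Z] for linf / c0 and [L] for a generalized limit on bounded
sequences, that is, a functional of norm 1 that kills c0 and fixes constants.

Why the first claim holds.  Flatness over c0 of linf contains the behaviour of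
the functor [E |-> E (x)_p Z]: sending [e (x) z] to the constant sequence [e]
tensored with [z] defines a contraction from [E (x)_p linf] to the module
tensor product of [linf (x)_i E] and [linf], and applying [L] to the first
factor and the quotient map to the second one respects the relations and brings
the result back, contractively, to the class of [e (x) z] in [E (x)_p Z]
([proj_norm_quot_le_ctens]).  So the module norm dominates the norm in
[E (x)_p Z].  On the side of [F] the opposite estimate is needed, and it holds
up to epsilon after deleting finitely many coordinates of the [linf] factor:
that does not change classes modulo c0, and it makes the difference between two
lifts of the same element of [F (x) Z] arbitrarily small, because this
difference lies in [F (x) c0] ([tens_tail_small]).  Hence an isometric module
map forces an isometric map on [(x)_p Z] ([ctens_isometric_ptens]).

Why the corollary holds.  The injective norm on [linf (x) E] is the supremum of
the norms of the coordinates ([itens_linf_norm_le]), so these modules are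
homogeneous and tensoring with an isometry preserves isometry.  It remains to
exhibit one pair [E], [F].  Take [F = linf] and
[E = { x | x_0 + x_1 + x_2 = 0 }].  Let [w] be a primitive cube root of 1 and let
[v_k] in [Z] be the class of the sequence equal to [w^k] at even places and to
[w^(2k)] at odd places.  Since [v_0 + v_1 + v_2 = 0], the tensor
[t = sum_k e_k (x) v_k] comes from [E (x) Z], and in [F (x) Z] it is also half
the sum of the [(2 e_k - e_0 - e_1 - e_2) (x) v_k], so its norm there is at most
3/2.  In [E (x) Z] it is tested against the form that pairs the two Fourier
coefficients of [(x_0, x_1, x_2)] at the nontrivial characters of Z/3 with the
limits along even and along odd indices.  This form takes the value 2 at [t] and
has norm at most 5/4, since two coefficients with bounded values [a w^k + b w^-k]
satisfy [|a| + |b| <= 5/4 sup] ([cubert1_character_norm]).  Thus the norm of [t]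
drops from at least 8/5 to at most 3/2. *)

(** * Normed quotients and functionals *)

Section Norms.
Variable R : realType.
Local Notation C := R[i].

Lemma isometricP (X Y : normedZmodType C) (f : X -> Y) :
  isometric f <-> forall x, rnorm (f x) = rnorm x.
Proof.
by split=> h x; [rewrite /rnorm h|rewrite !rnormE h].
Qed.

Lemma functional_ext (V : normedModType C) (x y : V) :
  (forall g : {scalar V}, g x = g y) -> x = y.
Proof.
move=> h; have [g [_ gE]] := norming_functional (x - y).
by apply/eqP; rewrite -subr_eq0 -normr_eq0 -gE linearB /= h subrr.
Qed.

Section Quotient.
Variables (V : normedModType C) (W : closedSubspace V).

Fact nquot_pi_linear : linear (nquot_pi W).
Proof. by move=> c x y; rewrite nquot_piD nquot_piZ. Qed.
HB.instance Definition _ :=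
  GRing.isLinear.Build C V (nquot W) *:%R (nquot_pi W) nquot_pi_linear.

Lemma nquot_pi_eq0 x : nquot_pi W x = 0 <-> x \in subspace_pred W.
Proof. by rewrite -(linear0 (nquot_pi W)) nquot_piP subr0. Qed.

End Quotient.

(** The way to bound a quotient norm from below: a contraction that kills the
generators kills their closed span by continuity, so it factors contractively
through the quotient. *)
Lemma nquot_closed_span_norm_ge (V T : normedModType C) (S : set V)
    (g : {linear V -> T}) :
  (forall u, rnorm (g u) <= rnorm u) -> (forall u, S u -> g u = 0) ->
  forall u, rnorm (g u) <= rnorm (nquot_pi (closed_span S) u).
Proof.
move=> g1 gS u; apply: nquot_norm_ge => x /nquot_piP xu.
suff gxu : g (x - u) = 0.
  by move/eqP: gxu; rewrite linearB subr_eq0 => /eqP <-.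
apply: rnorm_eq0; apply/le_anti; rewrite rnorm_ge0 andbT.
apply/ler_addgt0Pr => e e0; rewrite add0r.
move: xu => /asboolP/closure_rnormP/(_ e e0)[_ [s [sS ->]] xus].
have gs0 : g (\sum_(p <- s) p.1 *: p.2) = 0.
  rewrite linear_sum big_seq big1 // => p /sS pS.
  by rewrite linearZ /= gS // scaler0.
by rewrite -(subr0 (g _)) -gs0 -linearB (le_trans (g1 _)) // ltW.
Qed.

Lemma nquot_functional (V : normedModType C) (W : closedSubspace V)
    (f : {scalar V}) :
  dual_ball V f -> (forall x, x \in subspace_pred W -> f x = 0) ->
  exists2 g : {scalar nquot W}, dual_ball _ g &
    forall x, g (nquot_pi W x) = f x.
Proof.
move=> f1 fW; pose g (q : nquot W) : C := f (repr q).
have gE x : g (nquot_pi W x) = f x.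
  apply/eqP; rewrite -subr_eq0 -linearB fW //.
  by apply/nquot_piP; rewrite nquot_piK.
have g_lin : linear_for *%R g.
  move=> c p q; rewrite -(nquot_piK p) -(nquot_piK q) -nquot_piZ -nquot_piD !gE.
  exact: linearP.
pose gM := GRing.isLinear.Build C (nquot W) C *%R g g_lin.
pose g' : {scalar nquot W} := HB.pack g gM.
exists g' => // q; apply: nquot_norm_ge => x <-.
by rewrite /= gE.
Qed.

End Norms.

(** * Tensor products of maps and of quotients *)

Section TensorFacts.
Variable R : realType.
Local Notation C := R[i].

Section MapSum.
Variables (K : fieldType) (X Y Z T : lmodType K).
Variables (f : {linear X -> Y}) (g : {linear Z -> T}).

Lemma tens_map_sum (s : seq (X * Z)) :
  tens_map f g (\sum_(p <- s) tensor p.1 p.2) =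
  \sum_(p <- s) tensor (f p.1) (g p.2).
Proof.
by rewrite linear_sum; apply: eq_bigr => p _; exact: tens_map_tensor.
Qed.
End MapSum.

Lemma tens_map_comp (K : fieldType) (X X1 Y Z Z1 T : lmodType K)
    (f1 : {linear X -> X1}) (f2 : {linear X1 -> Y}) (f : {linear X -> Y})
    (g1 : {linear Z -> Z1}) (g2 : {linear Z1 -> T}) (g : {linear Z -> T}) :
  (forall x, f2 (f1 x) = f x) -> (forall z, g2 (g1 z) = g z) ->
  forall u, tens_map f2 g2 (tens_map f1 g1 u) = tens_map f g u.
Proof.
move=> fE gE u; have [s ->] := tens_span u.
rewrite !tens_map_sum linear_sum; apply: eq_bigr => p _.
by rewrite /= tens_map_tensor fE gE.
Qed.

Lemma tens_map_square (K : fieldType) (X X1 X2 Y Z Z1 Z2 T : lmodType K)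
    (f1 : {linear X -> X1}) (f2 : {linear X1 -> Y})
    (f3 : {linear X -> X2}) (f4 : {linear X2 -> Y})
    (g1 : {linear Z -> Z1}) (g2 : {linear Z1 -> T})
    (g3 : {linear Z -> Z2}) (g4 : {linear Z2 -> T}) :
  (forall x, f2 (f1 x) = f4 (f3 x)) -> (forall z, g2 (g1 z) = g4 (g3 z)) ->
  forall u, tens_map f2 g2 (tens_map f1 g1 u) =
            tens_map f4 g4 (tens_map f3 g3 u).
Proof.
move=> fE gE u; rewrite (tens_map_comp (f := f4 \o f3) (g := g4 \o g3)) //.
by symmetry; exact: tens_map_comp.
Qed.

Variables (X Z : normedModType C).

Lemma proj_norm_tensor (x : X) (z : Z) :
  proj_norm (tensor x z) <= rnorm x * rnorm z.
Proof.
have h : tens_repr (tensor x z) [:: (x, z)] by rewrite /tens_repr /= big_seq1.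
by apply: le_trans (proj_norm_lb h) _; rewrite big_seq1.
Qed.

(** The projective norm is dual to bounded bilinear forms; this is the easy half
of that duality. *)
Lemma proj_norm_bilform (K : R) (b : bilform X Z) :
  (forall x z, rnorm (b x z) <= K * (rnorm x * rnorm z)) ->
  0 < K ->
  forall u : tens X Z, rnorm (u b) <= K * proj_norm u.
Proof.
move=> bK K0 u; rewrite -ler_pdivrMl //; apply: proj_norm_ge => s ->.
rewrite ler_pdivrMl // tens_val_sum (le_trans (rnorm_sum _ _)) // mulr_sumr.
by apply: ler_sum => p _; rewrite tensorE.
Qed.

Lemma proj_norm_map (Y T : normedModType C) (f : {linear X -> Y})
    (g : {linear Z -> T}) :
  (forall x, rnorm (f x) <= rnorm x) -> (forall z, rnorm (g z) <= rnorm z) ->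
  forall u, proj_norm (tens_map f g u) <= proj_norm u.
Proof.
move=> f1 g1 u; apply: proj_norm_ge => s ->.
have h : tens_repr (tens_map f g (\sum_(p <- s) tensor p.1 p.2))
    [seq (f p.1, g p.2) | p <- s].
  by rewrite /tens_repr /= big_map tens_map_sum.
rewrite (le_trans (proj_norm_lb h)) // big_map.
by apply: ler_sum => p _; rewrite ler_pM ?rnorm_ge0 ?f1 ?g1.
Qed.

End TensorFacts.

Section QuotientTensor.
Variables (R : realType) (X V : normedModType R[i]) (W : closedSubspace V).
Local Notation C := R[i].
Local Notation idX := (idfun : {linear X -> X}).
Local Notation pi := (nquot_pi W : {linear V -> nquot W}).

(** Tensoring with a quotient map gives again a quotient map for the projective
norm: each second factor of a good representation has a lift of nearly the same
norm. *)
Lemma tens_quot_lift (t : tens X (nquot W)) (e : R) : proj_norm t < e ->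
  exists2 w : tens X V, tens_map idX pi w = t & proj_norm w < e.
Proof.
have lift s (d : R) : 0 < d -> exists2 w : tens X V,
    tens_map idX pi w = \sum_(p <- s) tensor p.1 p.2 &
    proj_norm w <= \sum_(p <- s) rnorm p.1 * rnorm p.2 + d.
  elim: s d => [|[x q] s IHs] d d0.
    exists 0; rewrite ?big_nil ?linear0 //.
    by rewrite -[proj_norm 0]/(rnorm (0 : ptens X V)) rnorm0 add0r ltW.
  have d2 : 0 < d / 2 by rewrite divr_gt0.
  have k0 : 0 < rnorm x + 1 by rewrite ltr_wpDl // rnorm_ge0.
  have [w wE wn] := IHs _ d2.
  have [|y yq yn] := @nquot_norm_ex _ _ W q (rnorm q + d / 2 / (rnorm x + 1)).
    by rewrite rnorm_nquot ltrDl divr_gt0.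
  exists (tensor x y + w).
    by rewrite linearD /= wE tens_map_tensor big_cons /= -yq.
  rewrite big_cons /= [d in leRHS]splitr addrACA.
  rewrite (le_trans (proj_normD _ _)) // lerD //.
  rewrite (le_trans (proj_norm_tensor _ _)) //.
  rewrite (le_trans (ler_wpM2l (rnorm_ge0 x) (ltW yn))) // mulrDr lerD2l.
  by rewrite mulrA ler_pdivrMr // mulrC ler_wpM2l ?lerDl // ltW.
move=> /proj_norm_ex[s ts se].
have [|w wE wn] := lift s ((e - \sum_(p <- s) rnorm p.1 * rnorm p.2) / 2).
  by rewrite divr_gt0 // subr_gt0.
exists w; first by rewrite wE ts.
apply: le_lt_trans wn _; rewrite -ltrBrDl ltr_pdivrMr // mulr_natr mulr2n.
by rewrite ltrDl subr_gt0.
Qed.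

(** Right exactness of the tensor product.  By induction on a representation: if
the second factor [z] of the first term is nonzero in the quotient, a functional
that norms its class expresses the first factor by the others, and that term is
absorbed; otherwise [z] lies in [W] and the term is kept. *)
Lemma tens_quot_ker (w : tens X V) : tens_map idX pi w = 0 ->
  exists2 s, w = \sum_(p <- s) tensor p.1 p.2 &
    forall p, p \in s -> p.2 \in subspace_pred W.
Proof.
have [s ->] := tens_span w; rewrite tens_map_sum /=.
have [n] := ubnP (size s); elim: n s => // n IHn [|[x z] s] /=.
  by move=> _ _; exists [::].
rewrite ltnS => sn h; have [z0|z0] := eqVneq (nquot_pi W z) 0.
  have [|r rE rW] := IHn s sn.
    move: h; rewrite big_cons /= z0 (_ : tensor x 0 = 0) ?add0r //.
    by apply: tens_ext => b; rewrite tensorE linear0r.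
  exists ((x, z) :: r); first by rewrite !big_cons rE.
  by move=> p; rewrite inE => /orP[/eqP ->|/rW //]; apply/nquot_pi_eq0.
have [g [hg gz]] := norming_functional (nquot_pi W z).
have gz0 : g (nquot_pi W z) != 0 by rewrite gz normr_eq0.
(* Applying [g] to the second factors of the vanishing tensor solves for [x]. *)
pose k (t : V) := g (nquot_pi W t) / g (nquot_pi W z).
have xE : x = - \sum_(p <- s) k p.2 *: p.1.
  have sum0 : \sum_(p <- (x, z) :: s) g (nquot_pi W p.2) *: p.1 = 0.
    apply: functional_ext => f; rewrite linear0 linear_sum /=.
    move/(congr1 (fun u : tens X (nquot W) => u (prod_form f g))): h.
    rewrite tens_val_sum tens_val0 => h; rewrite -[RHS]h.
    by apply: eq_bigr => p _; rewrite linearZ /= mulrC.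
  move: sum0; rewrite big_cons /= => /(congr1 ( *:%R (g (nquot_pi W z))^-1)).
  rewrite scaler0 scalerDr scalerA mulVf // scale1r => /eqP.
  rewrite addr_eq0 => /eqP ->; congr (- _); rewrite scaler_sumr.
  by apply: eq_bigr => p _; rewrite scalerA mulrC.
pose s' := [seq (p.1, p.2 - k p.2 *: z) | p <- s].
have s'E (Y : lmodType C) (f : {linear V -> Y}) :
    \sum_(p <- s') tensor p.1 (f p.2) =
    \sum_(p <- (x, z) :: s) tensor p.1 (f p.2).
  apply: tens_ext => b; rewrite !tens_val_sum.
  rewrite big_map big_cons /= {1}xE linearNl linear_sumlz -sumrN -big_split /=.
  apply: eq_bigr => p _.
  by rewrite linearB linearZ linearBr linearZl_LR linearZr_LR addrC.
have [||r rE rW] := IHn s'; first by rewrite size_map.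
  by rewrite (s'E _ pi).
exists r => //; rewrite -rE; symmetry; exact: (s'E _ (idfun : {linear V -> V})).
Qed.

End QuotientTensor.

(** * Slice maps and the injective tensor product with bounded sequences *)

Section Slice.
Variables (R : realType) (X E : normedModType R[i]) (f : {scalar X}).
Local Notation C := R[i].

(** The map [f (x) id] followed by the identification of [C (x) E] with [E]; the
chosen representation does not matter, because functionals on [E] see only the
tensor itself. *)
Definition slice (u : itens X E) : E :=
  \sum_(p <- sval (cid (tens_span u))) f p.1 *: p.2.

Lemma slice_functional (g : {scalar E}) u :
  g (slice u) = (u : tens X E) (prod_form f g).
Proof.
rewrite /slice; case: cid => s us /=; rewrite linear_sum us tens_val_sum.
by apply: eq_bigr => p _; rewrite linearZ.
Qed.

Fact slice_linear : linear slice.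
Proof.
by move=> c u v; apply: functional_ext => g; rewrite linearP !slice_functional.
Qed.
HB.instance Definition _ :=
  GRing.isLinear.Build C (itens X E) E *:%R slice slice_linear.

Lemma slice_tensor x e : slice (tensor x e) = f x *: e.
Proof.
by apply: functional_ext => g; rewrite slice_functional linearZ.
Qed.

Lemma slice_sum (s : seq (X * E)) :
  slice (\sum_(p <- s) tensor p.1 p.2 : tens X E) = \sum_(p <- s) f p.1 *: p.2.
Proof.
by rewrite [LHS]linear_sum; apply: eq_bigr => p _; exact: slice_tensor.
Qed.

Lemma rnorm_slice : dual_ball X f -> forall u, rnorm (slice u) <= rnorm u.
Proof.
move=> f1 u; have [g [g1 gE]] := norming_functional (slice u).
have -> : rnorm (slice u) = rnorm (g (slice u)).
  by rewrite gE rnormE rnorm_real ger0_norm ?rnorm_ge0.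
by rewrite slice_functional; exact: inj_norm_ub.
Qed.

End Slice.

Lemma slice_map (R : realType) (X E F : normedModType R[i]) (f : {scalar X})
    (i : {linear E -> F}) (u : itens X E) :
  slice f (itens_map (idfun : {linear X -> X}) i u) = i (slice f u).
Proof.
have [s ->] := tens_span u; rewrite /itens_map tens_map_sum slice_sum linear_sum.
rewrite [RHS]linear_sum; apply: eq_bigr => p _.
by rewrite /= slice_tensor linearZ.
Qed.

Section InjLinf.
Variable R : realType.
Local Notation C := R[i].

Section Coordinate.
Variable n : nat.
Definition coordinate (x : linf R) : C := x n.
Fact coordinate_linear : linear_for *%R coordinate.
Proof. by []. Qed.
HB.instance Definition _ :=
  GRing.isLinear.Build C (linf R) C *%R coordinate coordinate_linear.

Lemma coordinate_dual : dual_ball (linf R) coordinate.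
Proof. by move=> x; exact: linf_norm_ub. Qed.
End Coordinate.

Lemma linf_sumE I (s : seq I) (F : I -> linf R) n :
  (\sum_(i <- s) F i) n = \sum_(i <- s) F i n.
Proof. exact: (linear_sum (coordinate n)). Qed.

Variable E : normedModType C.

(** With [rnorm_slice], this identifies [linf (x)_i E] with a space of bounded
[E]-valued sequences under the supremum norm.  Slicing [u] by [g] on the second
factor yields an element [y] of [linf] whose norm is read off coordinatewise, and
[f] cannot exceed that norm. *)
Lemma itens_linf_norm_le (u : itens (linf R) E) (r : R) :
  (forall n, rnorm (slice (coordinate n) u) <= r) -> rnorm u <= r.
Proof.
move=> ur; apply: inj_norm_le => f g f1 g1.
have [s us] := tens_span u.
pose y : linf R := \sum_(p <- s) g p.2 *: p.1.
have -> : (u : tens (linf R) E) (prod_form f g) = f y.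
  rewrite us tens_val_sum linear_sum; apply: eq_bigr => p _.
  by rewrite linearZ tensorE /= mulrC.
rewrite (le_trans (f1 _)) //; apply: linf_norm_le => n.
suff -> : y n = g (slice (coordinate n) u) by exact: le_trans (g1 _) (ur n).
rewrite us slice_sum linear_sum linf_sumE; apply: eq_bigr => p _.
by rewrite linearZ /= mulrC.
Qed.

Lemma slice_act (a : c0 R) (n : nat) (u : itens (linf R) E) :
  slice (coordinate n) (c0act a u) = (a : linf R) n *: slice (coordinate n) u.
Proof.
have [s ->] := tens_span u.
rewrite slice_sum itens_actE /itens_act tens_map_sum linear_sum scaler_sumr.
by apply: eq_bigr => p _; rewrite /= slice_tensor scalerA.
Qed.

Lemma rnorm_pn_act n (u : itens (linf R) E) :
  rnorm (c0act (pn n) u) = rnorm (slice (coordinate n) u).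
Proof.
apply/le_anti/andP; split.
  apply: itens_linf_norm_le => m; rewrite slice_act /=; have [->|_] := eqVneq m n.
    by rewrite scale1r.
  by rewrite scale0r rnorm0 rnorm_ge0.
have := rnorm_slice (coordinate_dual n) (c0act (pn n) u).
by rewrite slice_act /= eqxx scale1r.
Qed.

Lemma itens_linf_homogeneous : homogeneous (itens (linf R) E).
Proof.
move=> x y xy; have {}xy n : rnorm (slice (coordinate n) x) =
    rnorm (slice (coordinate n) y).
  by rewrite -!rnorm_pn_act /rnorm xy.
rewrite !rnormE; congr (_%:C); apply/le_anti/andP; split;
  apply: itens_linf_norm_le => n; [rewrite xy|rewrite -xy];
  exact: rnorm_slice (coordinate_dual n) _.
Qed.

End InjLinf.

Section InjLinfMap.
Variables (R : realType) (E F : normedModType R[i]) (i : {linear E -> F}).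
Local Notation idL := (idfun : {linear linf R -> linf R}).

Lemma itens_map_isometric : isometric i -> isometric (itens_map idL i).
Proof.
move=> /isometricP i1; apply/isometricP => u.
apply/le_anti/andP; split; apply: itens_linf_norm_le => n.
  by rewrite slice_map i1; exact: rnorm_slice (coordinate_dual n) _.
by rewrite -i1 -slice_map; exact: rnorm_slice (coordinate_dual n) _.
Qed.

Lemma itens_map_morphism : is_c0_morphism (itens_map idL i).
Proof. by move=> a u; apply: tens_map_square. Qed.

End InjLinfMap.

(** * Generalized limits and tails of sequences *)

Section Limits.
Variable R : realType.
Local Notation C := R[i].
Local Notation qc0 := (nquot_pi (c0_subspace R)).

Fact linf_cst_subproof (c : C) : (fun=> c) \in @bounded_seq R.
Proof. by apply/asboolP; exists (rnorm c). Qed.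
Definition linf_cst c : linf R := Linf (linf_cst_subproof c).

Lemma rnorm_linf_cst c : rnorm (linf_cst c) = rnorm c.
Proof.
apply/le_anti/andP; split; first by apply: linf_norm_le => n; exact: lexx.
exact: (linf_norm_ub (linf_cst c) 0%N).
Qed.

Lemma rnorm_qc0_cst1 : rnorm (qc0 (linf_cst 1)) = 1.
Proof.
have n1 : rnorm (1 : C) = 1 by rewrite /rnorm normr1.
apply/le_anti/andP; split.
  by rewrite (le_trans (nquot_norm_le _ _)) // rnorm_linf_cst n1.
apply: nquot_norm_ge => x /nquot_piP /c0_predP xc0.
apply/ler_addgt0Pr => e /xc0[N /(_ N (leqnn N))] xN.
rewrite -n1 -(subKr (x N) 1) (le_trans (rnormD _ _)) // lerD //.
  exact: linf_norm_ub.
by rewrite rnormN ltW.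
Qed.

(** A functional that norms the class of the constant 1 modulo c0. *)
Lemma generalized_limit_ex : exists L : {scalar linf R},
  [/\ dual_ball _ L, forall x, x \in @c0_pred R -> L x = 0 &
      forall c, L (linf_cst c) = c].
Proof.
have [f [f1 fE]] := norming_functional (qc0 (linf_cst 1)).
exists (f \o qc0 : {scalar linf R}); split=> [x|x xc0|c] /=.
- exact: le_trans (f1 _) (nquot_norm_le _ _).
- by rewrite (_ : qc0 x = 0) ?linear0 //; apply/nquot_pi_eq0.
have -> : linf_cst c = c *: linf_cst 1.
  by apply: linf_ext => n; rewrite -[LHS]mulr1.
by rewrite !linearZ /= fE rnormE rnorm_qc0_cst1 mulr1.
Qed.

Section Tail.
Variable N : nat.

Fact tail_subproof (x : linf R) :
  (fun n => if (n < N)%N then 0 else x n) \in @bounded_seq R.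
Proof.
apply/asboolP; exists (rnorm x) => n; case: ifP => _.
  by rewrite rnorm0 rnorm_ge0.
exact: linf_norm_ub.
Qed.
Definition tail x : linf R := Linf (tail_subproof x).

Fact tail_linear : linear tail.
Proof.
move=> c x y; apply: linf_ext => n.
rewrite -[RHS]/(c * tail x n + tail y n) /=; case: ifP => // _.
by rewrite mulr0 addr0.
Qed.
HB.instance Definition _ :=
  GRing.isLinear.Build C (linf R) (linf R) *:%R tail tail_linear.

Lemma rnorm_tail x : rnorm (tail x) <= rnorm x.
Proof.
apply: linf_norm_le => n /=; case: ifP => _; last exact: linf_norm_ub.
by rewrite rnorm0 rnorm_ge0.
Qed.

Lemma qc0_tail x : qc0 (tail x) = qc0 x.
Proof.
apply/nquot_piP/c0_predP => e e0; exists N => n Nn.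
suff -> : (tail x - x) n = 0 by rewrite rnorm0.
by rewrite -[LHS]/(tail x n - x n) /= ltnNge Nn /= subrr.
Qed.

End Tail.

Lemma tail_c0_small (x : linf R) (e : R) : x \in @c0_pred R -> 0 < e ->
  exists N, forall M, (N <= M)%N -> rnorm (tail M x) <= e.
Proof.
move=> /c0_predP h /h[N hN]; exists N => M NM.
apply: linf_norm_le => n /=; case: ltnP => [_|Mn].
  have := hN N (leqnn N); rewrite rnorm0 => /ltW; apply: le_trans.
  exact: rnorm_ge0.
by rewrite ltW // hN // (leq_trans NM).
Qed.

(** The kernel of the quotient map on [X (x) linf] is [X (x) c0], a finite sum of
tensors whose second factors have small tails. *)
Lemma tens_tail_small (X : normedModType C) (w : tens X (linf R)) (e : R) :
  tens_map (idfun : {linear X -> X}) qc0 w = 0 -> 0 < e ->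
  exists N, proj_norm (tens_map (idfun : {linear X -> X}) (tail N) w) < e.
Proof.
move=> /tens_quot_ker[s ->] sc0 e0.
suff [N hN] : exists N, forall M, (N <= M)%N ->
    \sum_(p <- s) rnorm p.1 * rnorm (tail M p.2) < e.
  exists N; apply: le_lt_trans (hN N (leqnn N)).
  have h : tens_repr (tens_map (idfun : {linear X -> X}) (tail N)
      (\sum_(p <- s) tensor p.1 p.2)) [seq (p.1, tail N p.2) | p <- s].
    by rewrite /tens_repr /= tens_map_sum big_map.
  by rewrite (le_trans (proj_norm_lb h)) // big_map.
elim: s e e0 sc0 => [|[x z] s IHs] e e0 sc0.
  by exists 0%N => M _; rewrite big_nil.
have e2 : 0 < e / 2 by rewrite divr_gt0.
have k0 : 0 < rnorm x + 1 by rewrite ltr_wpDl // rnorm_ge0.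
have [N1 h1] := tail_c0_small (sc0 (x, z) (mem_head _ _)) (divr_gt0 e2 k0).
have [|N2 h2] := IHs _ e2.
  by move=> p ps; apply: sc0; rewrite inE ps orbT.
exists (maxn N1 N2) => M; rewrite geq_max => /andP[/h1 {}h1 /h2 {}h2].
rewrite big_cons /= [e]splitr ler_ltD //.
rewrite (le_trans (ler_wpM2l (rnorm_ge0 x) h1)) //.
by rewrite mulrA ler_pdivrMr // mulrC ler_wpM2l ?lerDl // ltW.
Qed.

End Limits.

(** * From the module tensor product to the projective tensor product *)

Section ConstantTensor.
Variables (R : realType) (E : normedModType R[i]).
Local Notation C := R[i].

Definition cst_tensor (e : E) : itens (linf R) E := tensor (linf_cst 1) e.
Fact cst_tensor_linear : linear cst_tensor.
Proof. exact: tensor_linearr. Qed.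
HB.instance Definition _ :=
  GRing.isLinear.Build C E (itens (linf R) E) *:%R cst_tensor cst_tensor_linear.

Lemma rnorm_cst_tensor e : rnorm (cst_tensor e) <= rnorm e.
Proof.
apply: itens_linf_norm_le => n.
by rewrite slice_tensor /coordinate /= scale1r.
Qed.

End ConstantTensor.

Section Retraction.
Variables (R : realType) (E : normedModType R[i]).
Local Notation qc0 := (nquot_pi (c0_subspace R)).
Local Notation idL := (idfun : {linear linf R -> linf R}).
Local Notation idE := (idfun : {linear E -> E}).

(** The map [slice L (x) qc0], for a generalized limit [L], is a contraction that
vanishes on the module relations: both [L] and the quotient map kill
[c0 * linf], so the two terms of a relation vanish separately.  It undoes the
embedding by constant sequences. *)
Lemma proj_norm_quot_le_ctens (w : tens E (linf R)) :
  proj_norm (tens_map idE qc0 w) <=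
  rnorm (ctens_pi (ptens_map (@cst_tensor R E) idL w)).
Proof.
have [L [L1 Lc0 Lcst]] := generalized_limit_ex R.
have -> : tens_map idE qc0 w =
    ptens_map (slice L : {linear itens (linf R) E -> E}) qc0
      (ptens_map (@cst_tensor R E) idL w).
  symmetry; apply: tens_map_comp => // e.
  by rewrite /= /cst_tensor slice_tensor Lcst scale1r.
pose rho :
    {linear ptens (itens (linf R) E) (linf R) -> ptens E (linf_mod_c0 R)} :=
  ptens_map (slice L : {linear itens (linf R) E -> E}) qc0.
apply: (nquot_closed_span_norm_ge (g := rho)) => [u|_ [a [x [z ->]]]].
  by apply: proj_norm_map => [y|y]; [exact: rnorm_slice|exact: nquot_norm_le].
rewrite linearB /= /ptens_map !tens_map_tensor.
have slice0 : slice L (c0act a x) = 0.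
  have [s ->] := tens_span x.
  rewrite itens_actE /itens_act tens_map_sum [LHS]linear_sum big1 // => p _.
  by rewrite /= slice_tensor Lc0 ?scale0r // c0_mul_subproof.
have pi0 : qc0 (c0act a z) = 0 by apply/nquot_pi_eq0; exact: c0_mul_subproof.
rewrite [X in tensor X _ - _]slice0 [X in _ - tensor _ X]pi0.
apply: tens_ext => b.
by rewrite tens_valD tens_valN !tensorE linear0l linear0r subrr.
Qed.

End Retraction.

Section Transfer.
Variables (R : realType) (E F : normedModType R[i]) (i : {linear E -> F}).
Local Notation qc0 := (nquot_pi (c0_subspace R)).
Local Notation idL := (idfun : {linear linf R -> linf R}).
Local Notation idZ := (idfun : {linear linf_mod_c0 R -> linf_mod_c0 R}).
Local Notation idE := (idfun : {linear E -> E}).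
Local Notation idF := (idfun : {linear F -> F}).
Local Notation iX :=
  (itens_map idL i : {linear itens (linf R) E -> itens (linf R) F}).

(** Given [t], let [v] lift it to [E (x) linf] and let [w] be an almost optimal
lift of its image to [F (x) linf].  Cutting off enough initial coordinates makes
[w] and the image of [v] agree up to [e / 2] and still represents [t], so the
module norm of the truncated [v] lies above the norm of [t] and, computed on the
side of [F], below the norm of the image of [t] plus [e]. *)
Lemma ctens_isometric_ptens : isometric i ->
  isometric (ctens_map (linf R) iX) -> isometric (ptens_map i idZ).
Proof.
move=> i1 /isometricP iso; apply/isometricP => t.
have /isometricP i1' := i1.
have iX1 x : rnorm (iX x) = rnorm x.
  by move: x; apply/isometricP/itens_map_isometric.
apply/le_anti/andP; split.
  by apply: proj_norm_map => // x; rewrite i1'.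
apply/ler_addgt0Pr => e e0; have e2 : 0 < e / 2 by rewrite divr_gt0.
have [w wt wn] : exists2 w : tens F (linf R),
    tens_map idF qc0 w = ptens_map i idZ t &
    proj_norm w < rnorm (ptens_map i idZ t) + e / 2.
  by apply: tens_quot_lift; rewrite ltrDl.
have [v vt _] : exists2 v : tens E (linf R), tens_map idE qc0 v = t &
    proj_norm v < proj_norm t + 1.
  by apply: tens_quot_lift; rewrite ltrDl.
have [|N wv] := @tens_tail_small R F (tens_map i idL v - w) _ _ e2.
  rewrite linearB /= wt -vt /ptens_map.
  rewrite (tens_map_comp (f := i) (g := qc0)) //.
  by rewrite (tens_map_comp (f := i) (g := qc0)) // subrr.
pose v' := tens_map idE (tail N) v.
have -> : rnorm t = proj_norm (tens_map idE qc0 v').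
  rewrite -vt /v' (tens_map_comp (f := idE) (g := qc0)) // => z.
  exact: qc0_tail.
rewrite (le_trans (proj_norm_quot_le_ctens v')) //.
rewrite -iso (ctens_mapE (itens_map_morphism i)); last first.
  by exists 1 => x; rewrite mul1r iX1.
rewrite (le_trans (nquot_norm_le _ _)) //.
have -> : ptens_map iX idL (ptens_map (@cst_tensor R E) idL v') =
    ptens_map (@cst_tensor R F) idL (tens_map idF (tail N) (tens_map i idL v)).
  rewrite /v' /ptens_map.
  rewrite (tens_map_comp (f := @cst_tensor R E) (g := tail N)) //.
  rewrite (tens_map_comp (f := i) (g := tail N)) //.
  apply: tens_map_square => // x; exact: tens_map_tensor.
rewrite -(subrK w (tens_map i idL v)) [e]splitr addrA.
rewrite [X in ptens_map _ _ X]linearD.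
rewrite linearD (le_trans (rnormD _ _)) // [leRHS]addrC lerD //.
  apply: le_trans (ltW wv); apply: proj_norm_map => //; exact: rnorm_cst_tensor.
apply: le_trans (ltW wn).
apply: le_trans (_ : proj_norm (tens_map idF (tail N) w) <= _).
  apply: proj_norm_map => //; exact: rnorm_cst_tensor.
by apply: proj_norm_map => //; exact: rnorm_tail.
Qed.

End Transfer.

(** * The two nontrivial characters of Z/3 *)

Section CubeRoot.
Variable R : realType.
Local Notation C := R[i].

Lemma rnorm_sqr (z : C) : rnorm z ^+ 2 = complex.Re z ^+ 2 + complex.Im z ^+ 2.
Proof.
by rewrite /rnorm normc_def /= sqr_sqrtr // addr_ge0 // sqr_ge0.
Qed.

Definition cubert1 : C := (- 2^-1) +i* (Num.sqrt 3 / 2).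
Local Notation w := cubert1.

Lemma cubert1_root : w ^+ 2 = - 1 - w.
Proof.
have s3 : Num.sqrt 3 ^+ 2 = 3 :> R by rewrite sqr_sqrtr.
rewrite expr2; apply/eqP; rewrite eq_complex /=.
apply/andP; split; apply/eqP; nra.
Qed.

Lemma cubert1_cube : w ^+ 3 = 1.
Proof. by rewrite exprS cubert1_root mulrBr mulrN1 -expr2 cubert1_root; ring. Qed.

Lemma rnorm_cubert1 : rnorm w = 1.
Proof.
have s3 : Num.sqrt 3 ^+ 2 = 3 :> R by rewrite sqr_sqrtr.
have : rnorm w ^+ 2 = 1 by rewrite rnorm_sqr /=; nra.
have := rnorm_ge0 w; nra.
Qed.

(** The squared norms of the three values are [|a|^2 + |b|^2 + 2 Re (a b^* w^k)]
for [k = 0, 1, 2], in some order.  The real parts of a number [c] rotated by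
cube roots of unity cannot all be below [|c| / 2], so [M^2] is at least
[|a|^2 + |b|^2 + |a| |b|], which is at least [3/4 (|a| + |b|)^2].  The optimal
constant is [2 / sqrt 3]; the larger 5/4 keeps the arithmetic rational. *)
Lemma cubert1_character_norm (a b : C) (M : R) :
  rnorm (a + b) <= M -> rnorm (a * w + b * w ^+ 2) <= M ->
  rnorm (a * w ^+ 2 + b * w) <= M -> rnorm a + rnorm b <= 5 / 4 * M.
Proof.
rewrite cubert1_root => h0 h1 h2.
have s3 : Num.sqrt 3 ^+ 2 = 3 :> R by rewrite sqr_sqrtr.
have M0 : 0 <= M by exact: le_trans (rnorm_ge0 _) h0.
have sq (z : C) : rnorm z <= M ->
    complex.Re z ^+ 2 + complex.Im z ^+ 2 <= M ^+ 2.
  by move=> zM; rewrite -rnorm_sqr ler_pXn2r // nnegrE ?rnorm_ge0.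
move/sq: h0; move/sq: h1; move/sq: h2.
have := rnorm_sqr a; have := rnorm_sqr b.
move: (rnorm_ge0 a) (rnorm_ge0 b).
case: a b => [a1 a2] [b1 b2] /=; set A := rnorm _; set B := rnorm _.
move: (Num.sqrt 3) s3 A B => s s3 A B A0 B0 BE AE h2 h1 h0.
pose p := a1 * b1 + a2 * b2; pose q := a2 * b1 - a1 * b2.
pose D := M ^+ 2 - A ^+ 2 - B ^+ 2.
have g0 : 0 <= D - 2 * p by rewrite /D /p AE BE; nra.
(* The multiple of [s ^+ 2 - 3] that reduces the expanded squares modulo
   [s ^+ 2 = 3]. *)
have k : (s ^+ 2 - 3) * ((a1 ^+ 2 + a2 ^+ 2 + b1 ^+ 2 + b2 ^+ 2) / 4 - p / 2) = 0.
  by rewrite s3 subrr mul0r.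
have g1 : 0 <= D + p - s * q by rewrite /D /q AE BE; rewrite /p in k *; lra.
have g2 : 0 <= D + p + s * q by rewrite /D /q AE BE; rewrite /p in k *; lra.
have D0 : 0 <= D by lra.
have pq : p ^+ 2 + q ^+ 2 = (A * B) ^+ 2.
  by rewrite exprMn AE BE /p /q; ring.
have DAB : A * B <= D.
  rewrite -(@ler_pXn2r _ 2) ?nnegrE ?mulr_ge0 // -pq.
  (* The pairwise products of the three nonnegative numbers, which sum to
     [3 D], add up to [3 (D ^+ 2 - p ^+ 2 - q ^+ 2)]. *)
  have e1 := mulr_ge0 g0 g1; have e2 := mulr_ge0 g0 g2; have e3 := mulr_ge0 g1 g2.
  have : (s * q) ^+ 2 = 3 * q ^+ 2 by rewrite exprMn s3.
  nra.
have : A ^+ 2 + B ^+ 2 + A * B <= M ^+ 2 by rewrite /D in DAB; lra.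
move=> h; rewrite -(@ler_pXn2r _ 2) ?nnegrE ?mulr_ge0 ?addr_ge0 //.
have := sqr_ge0 (A - B); have := mulr_ge0 A0 B0; rewrite exprMn; lra.
Qed.
End CubeRoot.

(** * Limits along even and odd indices *)

Section LimitsAlongParity.
Variable R : realType.
Local Notation C := R[i].
Local Notation qc0 := (nquot_pi (c0_subspace R)).

Section Subsequence.
Variable j : nat.

Fact parity_subseq_subproof (x : linf R) :
  (fun n => x (n.*2 + j)%N) \in @bounded_seq R.
Proof. by apply/asboolP; exists (rnorm x) => n; exact: linf_norm_ub. Qed.
Definition parity_subseq x : linf R := Linf (parity_subseq_subproof x).

Fact parity_subseq_linear : linear parity_subseq.
Proof. by move=> c x y; apply: linf_ext. Qed.
HB.instance Definition _ := GRing.isLinear.Build C (linf R) (linf R) *:%R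
  parity_subseq parity_subseq_linear.

Lemma rnorm_parity_subseq x : rnorm (parity_subseq x) <= rnorm x.
Proof. by apply: linf_norm_le => n; exact: (linf_norm_ub x). Qed.

Lemma parity_subseq_c0 x : x \in @c0_pred R -> parity_subseq x \in @c0_pred R.
Proof.
move=> /c0_predP h; apply/c0_predP => e /h[N hN]; exists N => n Nn.
by apply: hN; rewrite (leq_trans Nn) // -addnn -addnA leq_addr.
Qed.

Lemma parity_limit_ex : exists2 f : {scalar linf_mod_c0 R}, dual_ball _ f &
  forall x c, parity_subseq x = linf_cst c -> f (qc0 x) = c.
Proof.
have [L [L1 Lc0 Lcst]] := generalized_limit_ex R.
have [||f f1 fE] := @nquot_functional _ _ (c0_subspace R)
    (L \o parity_subseq : {scalar linf R}).
- by move=> x; rewrite (le_trans (L1 _)) // rnorm_parity_subseq.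
- by move=> x xc0; rewrite /= Lc0 // parity_subseq_c0.
by exists f => // x c xc; rewrite fE /= xc Lcst.
Qed.

End Subsequence.

Fact parity_seq_subproof (a b : C) :
  (fun n => if odd n then b else a) \in @bounded_seq R.
Proof.
apply/asboolP; exists (rnorm a + rnorm b) => n.
by case: ifP => _; rewrite ?lerDl ?lerDr rnorm_ge0.
Qed.
Definition parity_seq a b : linf R := Linf (parity_seq_subproof a b).

Lemma rnorm_parity_seq a b (M : R) : rnorm a <= M -> rnorm b <= M ->
  rnorm (parity_seq a b) <= M.
Proof. by move=> aM bM; apply: linf_norm_le => n /=; case: ifP. Qed.

Lemma parity_subseqK a b :
  (parity_subseq 0 (parity_seq a b) = linf_cst a) *
  (parity_subseq 1 (parity_seq a b) = linf_cst b).
Proof.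
by split; apply: linf_ext => n /=; rewrite ?addn0 ?addn1 /= odd_double.
Qed.

End LimitsAlongParity.

(** * A subspace on which the projective norm with linf / c0 drops *)

Section ZeroSum.
Variable R : realType.
Local Notation C := R[i].

Definition zerosum_pred : {pred linf R} :=
  [pred x : linf R | x 0%N + x 1%N + x 2%N == 0].

Fact zerosum_submod : submod_closed zerosum_pred.
Proof.
split=> [|c x y /eqP hx /eqP hy]; apply/eqP; first by rewrite !addr0.
transitivity (c * (x 0%N + x 1%N + x 2%N) + (y 0%N + y 1%N + y 2%N)).
  rewrite -[LHS]/((c * x 0%N + y 0%N) + (c * x 1%N + y 1%N) +
    (c * x 2%N + y 2%N)).
  ring.
by rewrite hx hy mulr0 addr0.
Qed.
HB.instance Definition _ :=
  GRing.isSubmodClosed.Build C (linf R) zerosum_pred zerosum_submod.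

Record zerosum :=
  ZeroSum { zerosum_val :> linf R ; zerosum_valP : zerosum_val \in zerosum_pred }.
HB.instance Definition _ := [isSub for zerosum_val].
HB.instance Definition _ := [Choice of zerosum by <:].
HB.instance Definition _ := [SubChoice_isSubLmodule of zerosum by <:].

Let zerosum_normD (x y : zerosum) :
  rnorm (zerosum_val (x + y)) <= rnorm (zerosum_val x) + rnorm (zerosum_val y).
Proof. exact: rnormD. Qed.
Let zerosum_normZ (c : C) (x : zerosum) :
  rnorm (zerosum_val (c *: x)) = rnorm c * rnorm (zerosum_val x).
Proof. exact: rnormZ. Qed.
Let zerosum_norm0_eq0 (x : zerosum) : rnorm (zerosum_val x) = 0 -> x = 0.
Proof. by move=> /rnorm_eq0 x0; apply: val_inj. Qed.
HB.instance Definition _ := Lmodule_hasRealNorm.Build R zerosum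
  zerosum_normD zerosum_normZ zerosum_norm0_eq0.

Fact zerosum_val_linear : linear zerosum_val.
Proof. by []. Qed.
HB.instance Definition _ := GRing.isLinear.Build C zerosum (linf R) *:%R
  zerosum_val zerosum_val_linear.

Lemma zerosum_val_isometric : isometric zerosum_val.
Proof. by apply/isometricP. Qed.

Local Notation e_ := (fun k => pn k : linf R).

Fact zerosum_diff_subproof (j : nat) : (j < 2)%N ->
  e_ j - e_ 2%N \in zerosum_pred.
Proof.
move=> j2; apply/eqP.
rewrite -[LHS]/((e_ j 0%N - e_ 2%N 0%N) + (e_ j 1%N - e_ 2%N 1%N) +
  (e_ j 2%N - e_ 2%N 2%N)) /=.
by case: j j2 => [|[|]] //= _; ring.
Qed.
Definition zerosum_diff j (j2 : (j < 2)%N) := ZeroSum (zerosum_diff_subproof j2).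

Lemma zerosum_diffE j (j2 : (j < 2)%N) n :
  zerosum_diff j2 n = (n == j)%:R - (n == 2)%:R.
Proof. by []. Qed.

End ZeroSum.

Section SumForm.
Variables (R : realType) (Z : normedModType R[i]) (f g : {scalar Z}).
Local Notation C := R[i].
Local Notation w := (cubert1 R).

(** With [(u, v)] equal to [(w^2, w)] or [(w, w^2)], the Fourier coefficient of
[(x_0, x_1, x_2)] at one of the two nontrivial characters of Z/3. *)
Definition fourier3 (u v : C) (x : linf R) : C :=
  (x 0%N + u * x 1%N + v * x 2%N) / 3.

Fact fourier3_linear u v : linear_for *%R (fourier3 u v).
Proof.
move=> c x y; rewrite /fourier3.
rewrite -[LHS]/((c * x 0%N + y 0%N + u * (c * x 1%N + y 1%N) +
  v * (c * x 2%N + y 2%N)) / 3).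
ring.
Qed.

Definition fourier_form (x : zerosum R) (z : Z) : C :=
  fourier3 (w ^+ 2) w x * f z + fourier3 w (w ^+ 2) x * g z.

Fact fourier_form_bilinear : bilinear_for *%R *%R fourier_form.
Proof.
split=> [z c x y|x c z t]; rewrite /fourier_form.
  by rewrite !linearP !fourier3_linear /=; ring.
by rewrite !linearP /=; ring.
Qed.
HB.instance Definition _ := bilinear_isBilinear.Build C (zerosum R) Z C *%R *%R
  fourier_form fourier_form_bilinear.

(** The coefficient at the trivial character is 0 on [zerosum], so Fourier
inversion writes the first three coordinates as [a w^k + b w^(2k)]. *)
Lemma rnorm_fourier_form (x : zerosum R) (z : Z) :
  dual_ball Z f -> dual_ball Z g ->
  rnorm (fourier_form x z) <= 5 / 4 * (rnorm x * rnorm z).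
Proof.
move=> f1 g1; rewrite /fourier_form.
set a := fourier3 (w ^+ 2) w x; set b := fourier3 w (w ^+ 2) x.
have wr := cubert1_root R.
have w3 := cubert1_cube R.
have /eqP x0 : x 0%N + x 1%N + x 2%N == 0 := zerosum_valP x.
have x2 : x 2%N = - (x 0%N + x 1%N) by apply/eqP; rewrite -addr_eq0 addrC x0.
have ab : rnorm a + rnorm b <= 5 / 4 * rnorm x.
  apply: cubert1_character_norm.
  - have -> : a + b = x 0%N by rewrite /a /b /fourier3 x2 wr; field.
    exact: linf_norm_ub.
  - have -> : a * w + b * w ^+ 2 = x 1%N.
      transitivity (((w ^+ 2 + w) * x 0%N + 2 * w ^+ 3 * x 1%N +
        (w ^+ 2 + w ^+ 3 * w) * x 2%N) / 3).
        by rewrite /a /b /fourier3; field.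
      by rewrite w3 wr x2; field.
    exact: linf_norm_ub.
  - have -> : a * w ^+ 2 + b * w = x 2%N.
      transitivity (((w ^+ 2 + w) * x 0%N + (w ^+ 3 * w + w ^+ 2) * x 1%N +
        2 * w ^+ 3 * x 2%N) / 3).
        by rewrite /a /b /fourier3; field.
      by rewrite w3 wr x2; field.
    exact: linf_norm_ub.
move: a b ab => a b ab.
rewrite (le_trans (rnormD _ _)) // !rnormM mulrA.
apply: le_trans (ler_wpM2r (rnorm_ge0 z) ab).
by rewrite mulrDl lerD // ler_wpM2l ?rnorm_ge0 ?f1 ?g1.
Qed.

End SumForm.

Section Counterexample.
Variable R : realType.
Local Notation C := R[i].
Local Notation w := (cubert1 R).
Local Notation Z := (linf_mod_c0 R).
Local Notation qc0 := (nquot_pi (c0_subspace R)).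
Local Notation e_ := (fun k => pn k : linf R).

Definition rotor (k : nat) : Z := qc0 (parity_seq (w ^+ k) (w ^+ (2 * k))).

Lemma rnorm_rotor k : rnorm (rotor k) <= 1.
Proof.
have n1 m : rnorm (w ^+ m) = 1.
  elim: m => [|m IHm]; first by rewrite expr0 /rnorm normr1.
  by rewrite exprS rnormM IHm rnorm_cubert1 mulr1.
rewrite (le_trans (nquot_norm_le _ _)) //.
by apply: rnorm_parity_seq; rewrite n1.
Qed.

Lemma rotor_sum : rotor 2 = - rotor 0 - rotor 1.
Proof.
rewrite /rotor -linearN -linearB /=; congr nquot_pi; apply: linf_ext => n.
have wr := cubert1_root R.
have w4 : w ^+ 4 = w by rewrite (exprM w 2 2) wr sqrrB sqrrN expr1n wr; ring.
rewrite -[RHS]/(- parity_seq _ _ n - parity_seq _ _ n) /= expr0.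
by case: ifP => _; rewrite ?w4 wr ?opprD ?opprK; ring.
Qed.

(** The tensor [sum_k e_k (x) v_k] for [v_k = rotor k], rewritten with
[v_2 = - v_0 - v_1] so that its first factors are zero-sum vectors. *)
Definition gap_tensor : ptens (zerosum R) Z :=
  tensor (zerosum_diff R (isT : (0 < 2)%N)) (rotor 0) +
  tensor (zerosum_diff R (isT : (1 < 2)%N)) (rotor 1) :> tens (zerosum R) Z.

(** The test form evaluates to 2 and has norm at most 5/4. *)
Lemma gap_tensor_norm_ge : 8 / 5 <= rnorm gap_tensor.
Proof.
have [f f1 fE] := parity_limit_ex R 0; have [g g1 gE] := parity_limit_ex R 1.
have fr k : f (rotor k) = w ^+ k by apply: fE; rewrite parity_subseqK.
have gr k : g (rotor k) = w ^+ (2 * k) by apply: gE; rewrite parity_subseqK.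
have K : 0 < 5 / 4 :> R by lra.
have := proj_norm_bilform (b := fourier_form f g)
  (fun x z => rnorm_fourier_form x z f1 g1) K gap_tensor.
have -> : (gap_tensor : tens (zerosum R) Z) (fourier_form f g) = 2.
  rewrite tens_valD !tensorE /= /fourier_form !fr !gr /fourier3.
  rewrite !zerosum_diffE /=.
  transitivity ((2 - w - 2 * w ^+ 2 + 2 * w ^+ 3 - w ^+ 3 * w) / 3).
    by field.
  by rewrite cubert1_cube cubert1_root; field.
have -> : rnorm (2 : C) = 2.
  rewrite (_ : 2 = (2 : R)%:C :> C) ?rnorm_real ?ger0_norm //.
  by rewrite rmorph_nat.
rewrite rnorm_ptens; lra.
Qed.

Lemma rnorm_signs (s0 s1 s2 : C) :
  rnorm s0 <= 1 -> rnorm s1 <= 1 -> rnorm s2 <= 1 ->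
  rnorm (s0 *: e_ 0%N + s1 *: e_ 1%N + s2 *: e_ 2%N) <= 1.
Proof.
move=> h0 h1 h2; apply: linf_norm_le => n.
rewrite -[(_ + _ : linf R) n]/(s0 * e_ 0%N n + s1 * e_ 1%N n + s2 * e_ 2%N n) /=.
case: n => [|[|[|n]]] /=; rewrite !(mulr0, mulr1, addr0, add0r) // rnorm0.
exact: ler01.
Qed.

(** As the [rotor k] sum to 0, subtracting a fixed vector from all first factors
[e_k] leaves the tensor unchanged; subtracting [(e_0 + e_1 + e_2) / 2] halves
their norms. *)
Lemma gap_tensor_norm_le :
  rnorm (ptens_map (zerosum_val (R := R)) (idfun : {linear Z -> Z}) gap_tensor)
   <= 3 / 2.
Proof.
pose s (k j : nat) : C := if j == k then 1 else -1.
pose x k : linf R := s k 0%N *: e_ 0%N + s k 1%N *: e_ 1%N + s k 2%N *: e_ 2%N.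
have x1 k : rnorm (x k) <= 1.
  by apply: rnorm_signs; rewrite /s; case: ifP; rewrite ?rnormN /rnorm normr1.
have h : tens_repr
    (ptens_map (zerosum_val (R := R)) (idfun : {linear Z -> Z}) gap_tensor)
    [seq (2^-1 *: x k, rotor k) | k <- iota 0 3].
  rewrite /tens_repr /= !big_cons big_nil addr0 /ptens_map linearD /=.
  rewrite !tens_map_tensor /= rotor_sum; apply: tens_ext => b.
  rewrite !tens_valD !tensorE.
  rewrite !(linearBl, linearZl_LR, linearDl, linearNr, linearBr) /=.
  by rewrite /s /=; field.
rewrite rnorm_ptens (le_trans (proj_norm_lb h)) // big_map.
rewrite (le_trans (_ : _ <= \sum_(k <- iota 0 3) 2^-1)) //.
  apply: ler_sum => k _ /=; rewrite rnormZ.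
  have -> : rnorm (2^-1 : C) = 2^-1.
    rewrite (_ : 2^-1 = (2^-1 : R)%:C :> C) ?rnorm_real ?ger0_norm //.
    by rewrite fmorphV rmorph_nat.
  have := ler_pM (rnorm_ge0 _) (rnorm_ge0 _) (x1 k) (rnorm_rotor k).
  rewrite -mulrA; lra.
rewrite /= !big_cons big_nil; lra.
Qed.

End Counterexample.

Theorem theorem4p3 (R : realType) :
  (forall (E F : normedModType R[i]) (i : {linear E -> F}),
     isometric i ->
     ~ isometric
         (ptens_map i (idfun : {linear linf_mod_c0 R -> linf_mod_c0 R})) ->
     ~ isometric
         (ctens_map (linf R)
            (itens_map (idfun : {linear linf R -> linf R}) i
              : {linear itens (linf R) E -> itens (linf R) F})))
  /\ ~ extremely_flat (@homogeneous R) (linf R).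
Proof.
split=> [E F i i1 niso iso|flat].
  exact: niso (ctens_isometric_ptens i1 iso).
have i1 := @zerosum_val_isometric R.
have /isometricP/(_ (gap_tensor R)) gap := ctens_isometric_ptens i1
  (flat _ _ _ (@itens_linf_homogeneous R _) (@itens_linf_homogeneous R _)
    (itens_map_morphism _) (itens_map_isometric i1)).
have := gap_tensor_norm_ge R; have := gap_tensor_norm_le R.
rewrite gap; lra.
Qed.
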